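(* In the setting and under the standing assumptions (problem regularity, parameter, stochastic gradient and matrix assumptions) stated in the context, suppose in addition that there exist $x_\star\in\mathcal X$ with $c(x_\star)=0$, $\mu\in\mathbb R_{>1}$ and $\epsilon\in\mathbb R_{>0}$ such that for all $x\in\mathcal X_{\epsilon,x_\star}:=\{x\in\mathcal X:\|x-x_\star\|_2\le\epsilon\}$ one has $$\phi_\tau(x)-\phi_\tau(x_\star)\ \begin{cases}=0 & \text{if } x=x_\star,\\ \in\big(0,\ \mu(\tau\|Z(x)^T\nabla f(x)\|_2^2+\|c(x)\|_2)\big] & \text{otherwise,}\end{cases}$$ where, for all $x\in\mathcal X_{\epsilon,x_\star}$, $Z(x)\in\mathbb R^{n\times(n-m)}$ is some matrix with orthonormal columns that form a basis for the null space of $\nabla c(x)^T$. If $\limsup_{k\to\infty}\|X_k-x_\star\|_2\le\epsilon$ almost surely, then, almost surely as $k\to\infty$, $$\phi_\tau(X_k)\to\phi_\tau(x_\star),\qquad X_k\to x_\star,\qquad \begin{bmatrix}\nabla f(X_k)+\nabla c(X_k)Y_k^{\mathrm{true}}\\ c(X_k)\end{bmatrix}\to 0.$$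
   Context: Notation. $\mathbb N$ is the set of positive integers; $\mathbb S^n$ is the set of symmetric real $n\times n$ matrices; $\|\cdot\|_2$ is the Euclidean norm of a vector and the spectral norm of a matrix; $\sigma_{\min}$ is the smallest singular value. $\nabla c(x)\in\mathbb R^{n\times m}$ denotes the transpose of the Jacobian of $c$ at $x$. Problem. $\min_{x\in\mathbb R^n} f(x)$ subject to $c(x)=0$, where $f(x)=\mathbb E_\iota[F(x,\iota)]$, $f:\mathbb R^n\to\mathbb R$ and $c:\mathbb R^n\to\mathbb R^m$ are continuously differentiable, and $\iota$ is a random variable with probability space $(\Omega_\iota,\mathcal F_\iota,\mathbb P_\iota)$. Merit function. With a fixed $\tau\in\mathbb R_{>0}$, $\phi_\tau(x)=\tau f(x)+\|c(x)\|_1$. For $g\in\mathbb R^n$, $h\in\mathbb S^n$ and $d$ with $c(x)+\nabla c(x)^Td=0$, $\Delta q_\tau(x,g,h,d)=-\tau(g^Td+\tfrac12\max\{d^Thd,0\})+\|c(x)\|_1$. Algorithm (stochastic SQP). Inputs: $x_1\in\mathbb R^n$; constants $L_{\nabla f},\Gamma\in\mathbb R_{>0}$ that are Lipschitz constants over $\mathcal X$ (below), with respect to $\|\cdot\|_2$, of $\nabla f$ and $\nabla c$ respectively; $\tau,\xi\in\mathbb R_{>0}$; a sequence $\{\beta_k\}\subset(0,1]$ with $\sum_k\beta_k=\infty$ and $\sum_k\beta_k^2<\infty$. Set $X_1=x_1$. For each $k\in\mathbb N$: obtain a stochastic gradient estimator $G_k\in\mathbb R^n$ and a matrix $H_k\in\mathbb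 S^n$; compute $(D_k,Y_k)\in\mathbb R^n\times\mathbb R^m$ as the solution of $$\begin{bmatrix}H_k&\nabla c(X_k)\\ \nabla c(X_k)^T&0\end{bmatrix}\begin{bmatrix}D_k\\ Y_k\end{bmatrix}=-\begin{bmatrix}G_k\\ c(X_k)\end{bmatrix};$$ set $\alpha_k=\frac{\beta_k\tau\xi}{\tau L_{\nabla f}+\Gamma}\in(0,1]$ and $X_{k+1}=X_k+\alpha_kD_k$. Let $(D_k^{\mathrm{true}},Y_k^{\mathrm{true}})$ be the solution of the same system with $G_k$ replaced by $\nabla f(X_k)$. All random variables are defined on a probability space $(\Omega,\mathcal F,\mathbb P)$ with $\Omega=\prod_{k=1}^\infty\Omega_\iota$, where the $k$th component of $\omega\in\Omega$ determines the $k$th stochastic gradient estimate. $\mathcal F_1$ is the $\sigma$-algebra corresponding to the initial conditions and, for $k\ge2$, $\mathcal F_k$ is the $\sigma$-algebra defined by the initial conditions and $G_1,\dots,G_{k-1}$. Standing assumptions. (Problem regularity) There is an open convex set $\mathcal X\subseteq\mathbb R^n$ containing $\{X_k\}$ such that: $f$ is continuously differentiable and bounded below over $\mathcal X$; $\nabla f$ is bounded and Lipschitz continuous over $\mathcal X$; $c$ (with $m\le n$) is Lipschitz continuous, continuously differentiable and bounded over $\mathcal X$; $\nabla c^T$ is Lipschitz continuous over $\mathcal X$; and $\nabla c(x)^T$ has full row rank for all $x\in\mathcal X$ with singular values bounded below uniformly by a positive constant over $\mathcal X$. (Parameters) $\xi,\tau\in\mathbb R_{>0}$ are such that, for some $\nu\in(0,1)$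 and for all $k\in\mathbb N$ in any run: (i) $\xi\le\frac{\Delta q_\tau(X_k,G_k,H_k,D_k)}{\tau\|D_k\|_2^2}$ whenever $D_k\ne0$; (ii) with $\rho_k:=\nabla f(X_k)^TD_k^{\mathrm{true}}+\max\{(D_k^{\mathrm{true}})^TH_kD_k^{\mathrm{true}},0\}$, $\tau\le\frac{(1-\nu)\|c(X_k)\|_1}{\rho_k}$ whenever $\rho_k>0$. (Stochastic gradients) For all $k$, $\mathbb E[G_k|\mathcal F_k]=\nabla f(X_k)$, and there is $\sigma\in\mathbb R_{>0}$ such that $\mathbb E[\|G_k-\nabla f(X_k)\|_2^2|\mathcal F_k]\le\sigma^2$ for all $k$. (Matrices) For all $k$, $H_k\in\mathbb S^n$ is $\mathcal F_k$-measurable with $\|H_k\|_2\le\kappa_H$ for some $\kappa_H\in\mathbb R_{>0}$, and there is $\zeta\in(0,\kappa_H]$ such that, for all $k$, $u^TH_ku\ge\zeta\|u\|_2^2$ for all $u\in\mathrm{Null}(\nabla c(X_k)^T)$.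
   Formalization: The formal theorem adds the assumption that almost surely every limit point of {X_k} lies in the open set 𝒳; without it X_k may converge to a boundary point of 𝒳 other than x_⋆ and the claim X_k → x_⋆ fails. *)

(* Defs.v *)
From HB Require Import structures.
From mathcomp Require Import all_boot all_order all_algebra.
From mathcomp Require Import all_classical all_reals all_analysis.

Set Implicit Arguments.
Unset Strict Implicit.
Unset Printing Implicit Defensive.

Import Order.TTheory GRing.Theory Num.Theory.
Import numFieldNormedType.Exports.

Local Open Scope classical_set_scope.
Local Open Scope ring_scope.

(* The library norm on matrices is the max norm, hence the norms below; the
   topology is the same. *)

Definition dot (R : realType) (n : nat) (u v : 'cV[R]_n) : R :=
  (u^T *m v) 0 0.

Definition norm1 (R : realType) (n : nat) (u : 'cV[R]_n) : R :=
  \sum_i `|u i 0|.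

Definition norm2 (R : realType) (n : nat) (u : 'cV[R]_n) : R :=
  Num.sqrt (\sum_i u i 0 ^+ 2).

Definition spectral_norm (R : realType) (p q : nat) (A : 'M[R]_(p, q)) : R :=
  sup [set norm2 (A *m u) | u in [set u : 'cV[R]_q | norm2 u <= 1]].

(* For p <= q the singular values of a p x q matrix A are the square roots of
   the p eigenvalues of A *m A^T. *)
Definition singular_value (R : realType) (p q : nat) (A : 'M[R]_(p, q))
    (s : R) : Prop :=
  0 <= s /\ eigenvalue (A *m A^T) (s ^+ 2).

Definition gradient (R : realType) (n : nat) (f : 'cV[R]_n -> R)
    (x : 'cV[R]_n) : 'cV[R]_n :=
  \col_i 'D_(delta_mx i 0) (f : 'cV[R]_n -> R^o) x.

(* The transposed Jacobian: entry (i, j) is the derivative of the j-th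
   component of c along the i-th coordinate. *)
Definition nabla (R : realType) (n m : nat) (c : 'cV[R]_n -> 'cV[R]_m)
    (x : 'cV[R]_n) : 'M[R]_(n, m) :=
  \matrix_(i, j) ('D_(delta_mx i 0) c x) j 0.

Definition continuously_differentiable (R : realType) (n m : nat)
    (c : 'cV[R]_n -> 'cV[R]_m) : Prop :=
  (forall x, differentiable c x) /\ continuous (nabla c).

Definition continuously_differentiable_scalar (R : realType) (n : nat)
    (f : 'cV[R]_n -> R) : Prop :=
  (forall x, differentiable (f : 'cV[R]_n -> R^o) x) /\
  continuous (gradient f).

Definition merit (R : realType) (n m : nat) (f : 'cV[R]_n -> R)
    (c : 'cV[R]_n -> 'cV[R]_m) (tau : R) (x : 'cV[R]_n) : R :=
  tau * f x + norm1 (c x).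

Definition model_reduction (R : realType) (n m : nat)
    (c : 'cV[R]_n -> 'cV[R]_m) (tau : R) (x g : 'cV[R]_n) (h : 'M[R]_n)
    (d : 'cV[R]_n) : R :=
  - tau * (dot g d + 2^-1 * Num.max (dot d (h *m d)) 0) + norm1 (c x).

Definition solves_newton_system (R : realType) (n m : nat)
    (h : 'M[R]_n) (J : 'M[R]_(n, m)) (g : 'cV[R]_n) (cx : 'cV[R]_m)
    (d : 'cV[R]_n) (y : 'cV[R]_m) : Prop :=
  block_mx h J J^T 0 *m col_mx d y = - col_mx g cx.

(* The sigma-algebra on T generated by the components of the random vectors
   X1 and G 0, ..., G k.-1. *)
Definition history (T : Type) (R : realType) (n : nat) (X1 : T -> 'cV[R]_n)
    (G : nat -> T -> 'cV[R]_n) (k : nat) : set (set T) :=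
  <<s (\bigcup_i preimage_set_system setT (fun w => X1 w i 0) measurable)
      `|` (\bigcup_(j in `I_k) \bigcup_i
             preimage_set_system setT (fun w => G j w i 0) measurable) >>.

(* Y is a version of E[X | F], for F a sub-sigma-algebra of the measurable
   sets. *)
Record is_cond_expectation (d : measure_display) (T : measurableType d)
    (R : realType) (P : probability T R) (F : set (set T))
    (X Y : T -> R) : Prop := IsCondExpectation {
  ce_integrable : P.-integrable setT (EFin \o X) ;
  ce_measurable : measurable_fun [set: g_sigma_algebraType F]
                    (Y : g_sigma_algebraType F -> R) ;
  ce_version_integrable : P.-integrable setT (EFin \o Y) ;
  ce_integral : forall A, F A ->
    (\int[P]_(w in A) (Y w)%:E = \int[P]_(w in A) (X w)%:E)%E
}.

Record problem_regularity (R : realType) (n m : nat) (T : Type)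
    (f : 'cV[R]_n -> R) (c : 'cV[R]_n -> 'cV[R]_m) (Dom : set 'cV[R]_n)
    (X : nat -> T -> 'cV[R]_n) : Prop := ProblemRegularity {
  pr_dim : (m <= n)%N ;
  pr_f_C1 : continuously_differentiable_scalar f ;
  pr_c_C1 : continuously_differentiable c ;
  pr_open : open Dom ;
  pr_convex : convex_set (Dom : set (convex_lmodType 'cV[R]_n)) ;
  pr_iterates : forall k w, Dom (X k w) ;
  pr_f_bounded_below : exists b, forall x, Dom x -> b <= f x ;
  pr_grad_bounded : exists b, forall x, Dom x -> norm2 (gradient f x) <= b ;
  pr_grad_lipschitz : exists L, forall x y, Dom x -> Dom y ->
    norm2 (gradient f x - gradient f y) <= L * norm2 (x - y) ;
  pr_c_lipschitz : exists L, forall x y, Dom x -> Dom y ->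
    norm2 (c x - c y) <= L * norm2 (x - y) ;
  pr_c_bounded : exists b, forall x, Dom x -> norm2 (c x) <= b ;
  pr_nabla_lipschitz : exists L, forall x y, Dom x -> Dom y ->
    spectral_norm ((nabla c x)^T - (nabla c y)^T) <= L * norm2 (x - y) ;
  pr_full_row_rank : forall x, Dom x -> row_free (nabla c x)^T ;
  pr_singular_values : exists2 s0, 0 < s0 &
    forall x s, Dom x -> singular_value (nabla c x)^T s -> s0 <= s
}.

(* Indices are shifted by one: X 0 is the first iterate. *)
Record stochastic_sqp (R : realType) (n m : nat) (T : Type)
    (f : 'cV[R]_n -> R) (c : 'cV[R]_n -> 'cV[R]_m) (Dom : set 'cV[R]_n)
    (x1 : 'cV[R]_n) (Lf Gam tau xi : R) (beta alpha : nat -> R)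
    (X G D Dtrue : nat -> T -> 'cV[R]_n) (Y Ytrue : nat -> T -> 'cV[R]_m)
    (H : nat -> T -> 'M[R]_n) : Prop := StochasticSQP {
  sqp_Lf_gt0 : 0 < Lf ;
  sqp_Lf : forall x y, Dom x -> Dom y ->
    norm2 (gradient f x - gradient f y) <= Lf * norm2 (x - y) ;
  sqp_Gam_gt0 : 0 < Gam ;
  sqp_Gam : forall x y, Dom x -> Dom y ->
    spectral_norm (nabla c x - nabla c y) <= Gam * norm2 (x - y) ;
  sqp_tau_gt0 : 0 < tau ;
  sqp_xi_gt0 : 0 < xi ;
  sqp_beta : forall k, 0 < beta k <= 1 ;
  sqp_beta_sum : series beta @ \oo --> +oo ;
  sqp_beta_sum_sqr : cvgn (series (fun k => beta k ^+ 2)) ;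
  sqp_alpha : forall k, alpha k = beta k * tau * xi / (tau * Lf + Gam) ;
  sqp_alpha_itv : forall k, 0 < alpha k <= 1 ;
  sqp_init : forall w, X 0%N w = x1 ;
  sqp_direction : forall k w,
    solves_newton_system (H k w) (nabla c (X k w)) (G k w) (c (X k w))
      (D k w) (Y k w) ;
  sqp_step : forall k w, X k.+1 w = X k w + alpha k *: D k w ;
  sqp_true_direction : forall k w,
    solves_newton_system (H k w) (nabla c (X k w)) (gradient f (X k w))
      (c (X k w)) (Dtrue k w) (Ytrue k w)
}.

Definition parameter_assumption (R : realType) (n m : nat) (T : Type)
    (f : 'cV[R]_n -> R) (c : 'cV[R]_n -> 'cV[R]_m) (tau xi : R)
    (X G D Dtrue : nat -> T -> 'cV[R]_n) (H : nat -> T -> 'M[R]_n) : Prop :=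
  exists2 nu : R, 0 < nu < 1 & forall k w,
    (D k w != 0 ->
       xi <= model_reduction c tau (X k w) (G k w) (H k w) (D k w)
             / (tau * norm2 (D k w) ^+ 2)) /\
    (let rho := dot (gradient f (X k w)) (Dtrue k w)
                + Num.max (dot (Dtrue k w) (H k w *m Dtrue k w)) 0 in
     0 < rho -> tau <= (1 - nu) * norm1 (c (X k w)) / rho).

Record stochastic_gradient_assumption (d : measure_display)
    (T : measurableType d) (R : realType) (P : probability T R) (n : nat)
    (f : 'cV[R]_n -> R) (X G : nat -> T -> 'cV[R]_n) : Prop :=
  StochasticGradientAssumption {
  sg_measurable : forall k i, measurable_fun setT (fun w => G k w i 0) ;
  sg_unbiased : forall k i,
    is_cond_expectation P (history (X 0%N) G k) (fun w => G k w i 0)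
      (fun w => gradient f (X k w) i 0) ;
  sg_variance : exists2 sigma : R, 0 < sigma & forall k,
    exists2 V : T -> R,
      is_cond_expectation P (history (X 0%N) G k)
        (fun w => norm2 (G k w - gradient f (X k w)) ^+ 2) V &
      {ae P, forall w, V w <= sigma ^+ 2}
}.

Record matrix_assumption (R : realType) (n m : nat) (T : pointedType)
    (c : 'cV[R]_n -> 'cV[R]_m) (X G : nat -> T -> 'cV[R]_n)
    (H : nat -> T -> 'M[R]_n) : Prop := MatrixAssumption {
  mx_symmetric : forall k w, (H k w)^T = H k w ;
  mx_measurable : forall k i j,
    measurable_fun [set: g_sigma_algebraType (history (X 0%N) G k)]
      ((fun w => H k w i j) :
         g_sigma_algebraType (history (X 0%N) G k) -> R) ;
  mx_bounds : exists kappa zeta : R,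
    [/\ 0 < kappa, 0 < zeta <= kappa,
        forall k w, spectral_norm (H k w) <= kappa &
        forall k w (u : 'cV[R]_n), (nabla c (X k w))^T *m u = 0 ->
          zeta * norm2 u ^+ 2 <= dot u (H k w *m u)]
}.

Definition orthonormal_null_basis (R : realType) (n m p : nat)
    (A : 'M[R]_(m, n)) (Z : 'M[R]_(n, p)) : Prop :=
  Z^T *m Z = 1%:M /\
  forall u : 'cV[R]_n, A *m u = 0 <-> exists v : 'cV[R]_p, u = Z *m v.

(* Main.v *)
Require Import Defs.
From HB Require Import structures.
From mathcomp Require Import all_boot all_order all_algebra.
From mathcomp Require Import all_classical all_reals all_analysis.
From mathcomp Require Import measurable_realfun.
From mathcomp Require Import ring lra.

Set Implicit Arguments.
Unset Strict Implicit.
Unset Printing Implicit Defensive.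

Import Order.TTheory GRing.Theory Num.Theory.
Import numFieldNormedType.Exports.

Local Open Scope classical_set_scope.
Local Open Scope ring_scope.

(** Along a run, one step changes the merit function [phi = tau f + |c|_1] by at
most

  [phi (X k+1) <= phi (X k) - alpha k * A k + alpha k * N k + C alpha k^2 |D k|^2],

where [A k = |c|_1 - tau grad f . Dtrue k] is the decrease that the
deterministic direction predicts for the linearised merit function
([merit_step]), and [N k = tau grad f . (D k - Dtrue k)] is the effect of the
error of the gradient estimate.  The condition on [tau] makes [A k]
nonnegative, and more precisely bounds it below by [nu |c|_1 + tau max(d.Hd, 0)]
with [d = Dtrue k] ([predicted_decrease_ge]).

Two facts make the perturbation summable almost surely.  The Newton matrix is
symmetric, so that [N k] is the scalar product of the gradient error with a
vector that is bounded and determined by the past ([adjoint_direction_dot]):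
the [alpha k * N k] are martingale differences whose variances are at most a
multiple of [alpha k^2], and their series converges
([martingale_series_cvg], [noise_series_cvg]).  Moreover [|D k|^2] is at most a
constant plus a multiple of the squared gradient error, whose expectation is
bounded, so that the second-order terms have a convergent sum of expectations
([gradient_error_series_cvg]).  As [phi] is bounded below, [phi (X k)] converges
and the [alpha k * A k] are summable ([perturbed_descent_cvg]); as the [alpha k]
are not, [A k] is arbitrarily small infinitely often
([weighted_series_frequently]).

The rest concerns a single run.  A run whose distance to [xs] has limit
superior at most [eps] may stay outside the closed ball of radius [eps], but its
limit points are in the ball.  A limit point [l] along indices with [A k -> 0]
satisfies [c l = 0]; by coercivity of [H] on the null space of the constraint
Jacobian, [Dtrue k -> 0] along these indices ([curvature_bound]), and the first
block row of the Newton system then says that [grad f l] is orthogonal to that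
null space ([stationary_subsequence_limit]).  Hence the upper bound in the
growth condition vanishes at [l], which forces [l = xs] and identifies the limit
of [phi (X k)] as [phi xs] ([merit_limit]).  Any other limit point of the run in
the ball would have the merit value [phi xs], contrary to strict growth, so
that [X k -> xs] ([iterates_limit]).  Finally [xs] has a multiplier [ys], and
[(Dtrue k, Ytrue k + ys)] solves the Newton system with the vanishing data
[grad f (X k) - J ys] and [c (X k)]; the stability bound
[newton_direction_bound] gives [Dtrue k -> 0], and the residual is [- H Dtrue]
([kkt_residual_limit]). *)

(** * Euclidean geometry *)

Section Euclidean.
Context {R : realType}.

Lemma dotE n (u v : 'cV[R]_n) : dot u v = \sum_i u i 0 * v i 0.
Proof. by rewrite /dot mxE; apply: eq_bigr => i _; rewrite mxE. Qed.

Lemma dotC n (u v : 'cV[R]_n) : dot u v = dot v u.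
Proof. by rewrite !dotE; apply: eq_bigr => i _; rewrite mulrC. Qed.

Lemma dotDl n (u v w : 'cV[R]_n) : dot (u + v) w = dot u w + dot v w.
Proof. by rewrite /dot linearD mulmxDl mxE. Qed.

Lemma dotDr n (u v w : 'cV[R]_n) : dot w (u + v) = dot w u + dot w v.
Proof. by rewrite /dot mulmxDr mxE. Qed.

Lemma dotZl n a (u v : 'cV[R]_n) : dot (a *: u) v = a * dot u v.
Proof. by rewrite /dot linearZ -scalemxAl mxE. Qed.

Lemma dotZr n a (u v : 'cV[R]_n) : dot u (a *: v) = a * dot u v.
Proof. by rewrite /dot -scalemxAr mxE. Qed.

Lemma dotNl n (u v : 'cV[R]_n) : dot (- u) v = - dot u v.
Proof. by rewrite -scaleN1r dotZl mulN1r. Qed.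

Lemma dotNr n (u v : 'cV[R]_n) : dot u (- v) = - dot u v.
Proof. by rewrite dotC dotNl dotC. Qed.

Lemma dotBl n (u v w : 'cV[R]_n) : dot (u - v) w = dot u w - dot v w.
Proof. by rewrite dotDl dotNl. Qed.

Lemma dotBr n (u v w : 'cV[R]_n) : dot w (u - v) = dot w u - dot w v.
Proof. by rewrite dotDr dotNr. Qed.

Lemma dot0l n (v : 'cV[R]_n) : dot 0 v = 0.
Proof. by rewrite -(scale0r 0) dotZl mul0r. Qed.

Lemma dot0r n (v : 'cV[R]_n) : dot v 0 = 0.
Proof. by rewrite dotC dot0l. Qed.

Lemma dot_adjoint p q (A : 'M[R]_(p, q)) u v : dot u (A *m v) = dot (A^T *m u) v.
Proof. by rewrite /dot trmx_mul trmxK mulmxA. Qed.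

Lemma dot_delta n (u : 'cV[R]_n) i : dot (delta_mx i 0) u = u i 0.
Proof.
rewrite dotE (bigD1 i) //= !mxE !eqxx mul1r big1 ?addr0 // => j ji.
by rewrite !mxE (negbTE ji) mul0r.
Qed.

Lemma dot_ge0 n (u : 'cV[R]_n) : 0 <= dot u u.
Proof. by rewrite dotE sumr_ge0 // => i _; rewrite -expr2 sqr_ge0. Qed.

Lemma norm2_sqr n (u : 'cV[R]_n) : norm2 u ^+ 2 = dot u u.
Proof.
rewrite /norm2 sqr_sqrtr; last by rewrite sumr_ge0 // => i _; rewrite sqr_ge0.
by rewrite dotE; apply: eq_bigr => i _; rewrite expr2.
Qed.

Lemma norm2E n (u : 'cV[R]_n) : norm2 u = Num.sqrt (dot u u).
Proof. by rewrite /norm2 dotE; congr Num.sqrt; apply: eq_bigr => i _;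
  rewrite expr2. Qed.

Lemma norm2_ge0 n (u : 'cV[R]_n) : 0 <= norm2 u.
Proof. exact: sqrtr_ge0. Qed.

Lemma norm2_sqr_le n (u : 'cV[R]_n) (a : R) :
  0 <= a -> dot u u <= a ^+ 2 -> norm2 u <= a.
Proof. by move=> a0; rewrite -norm2_sqr ler_pXn2r ?nnegrE ?norm2_ge0. Qed.

Lemma dot_eq0 n (u : 'cV[R]_n) : dot u u = 0 -> u = 0.
Proof.
rewrite dotE => /eqP; rewrite psumr_eq0 => [/allP u0|i _]; last first.
  by rewrite -expr2 sqr_ge0.
apply/matrixP => i j; rewrite ord1 mxE; apply/eqP.
by have /(_ (mem_index_enum i)) := u0 i; rewrite /= mulf_eq0 orbb.
Qed.

Lemma norm2_eq0 n (u : 'cV[R]_n) : (norm2 u == 0) = (u == 0).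
Proof.
apply/eqP/eqP => [u0|->]; first by apply: dot_eq0; rewrite -norm2_sqr u0 expr0n.
by apply/eqP; rewrite -sqrf_eq0 norm2_sqr dot0l.
Qed.

Lemma norm20 n : norm2 (0 : 'cV[R]_n) = 0.
Proof. by apply/eqP; rewrite norm2_eq0. Qed.

Lemma norm2N n (u : 'cV[R]_n) : norm2 (- u) = norm2 u.
Proof. by rewrite /norm2; congr Num.sqrt; apply: eq_bigr => i _;
  rewrite mxE sqrrN. Qed.

Lemma norm2Z n (a : R) (u : 'cV[R]_n) : norm2 (a *: u) = `|a| * norm2 u.
Proof.
apply/eqP; rewrite -(@eqrXn2 _ 2) ?mulr_ge0 ?norm2_ge0 //.
by rewrite exprMn !norm2_sqr dotZl dotZr mulrA -expr2 real_normK ?num_real.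
Qed.

(** The discriminant argument, made polynomial: the square of
    [|v|^2 u - (u.v) v] is nonnegative. *)
Lemma cauchy_schwarz_sqr n (u v : 'cV[R]_n) :
  dot u v ^+ 2 <= dot u u * dot v v.
Proof.
have [/dot_eq0 ->|v0] := eqVneq (dot v v) 0;
  first by rewrite !dot0r expr0n mulr0.
have vp : 0 < dot v v by rewrite lt_neqAle eq_sym v0 dot_ge0.
have := dot_ge0 (dot v v *: u - dot u v *: v).
rewrite dotBl !dotBr !dotZl !dotZr [dot v u]dotC => h.
rewrite -(ler_pM2l vp) -subr_ge0; apply: le_trans h _.
by rewrite le_eqVlt; apply/orP; left; apply/eqP; ring.
Qed.

Lemma cauchy_schwarz n (u v : 'cV[R]_n) : `|dot u v| <= norm2 u * norm2 v.
Proof.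
rewrite -(@ler_pXn2r _ 2) ?nnegrE ?mulr_ge0 ?norm2_ge0 //.
by rewrite exprMn !norm2_sqr real_normK ?num_real // cauchy_schwarz_sqr.
Qed.

Lemma norm2D n (u v : 'cV[R]_n) : norm2 (u + v) <= norm2 u + norm2 v.
Proof.
apply: norm2_sqr_le; first by rewrite addr_ge0 ?norm2_ge0.
rewrite dotDl !dotDr [dot v u]dotC sqrrD !norm2_sqr.
have := le_trans (ler_norm _) (cauchy_schwarz u v); lra.
Qed.

Lemma norm2B n (u v : 'cV[R]_n) : norm2 (u - v) <= norm2 u + norm2 v.
Proof. by rewrite -(norm2N v) norm2D. Qed.

Lemma norm2_delta n i : norm2 (delta_mx i 0 : 'cV[R]_n) = 1.
Proof.
by apply/eqP;
  rewrite -(@eqrXn2 _ 2) ?norm2_ge0 // norm2_sqr dot_delta mxE !eqxx expr1n.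
Qed.

Lemma coord_le_norm2 n (u : 'cV[R]_n) i : `|u i 0| <= norm2 u.
Proof.
rewrite -dot_delta; apply: le_trans (cauchy_schwarz _ _) _.
by rewrite norm2_delta mul1r.
Qed.

Lemma norm1_ge0 n (u : 'cV[R]_n) : 0 <= norm1 u.
Proof. by apply: sumr_ge0. Qed.

Lemma norm1D n (u v : 'cV[R]_n) : norm1 (u + v) <= norm1 u + norm1 v.
Proof. by rewrite /norm1 -big_split ler_sum // => i _;
  rewrite mxE ler_normD. Qed.

Lemma norm1Z n (a : R) (u : 'cV[R]_n) : norm1 (a *: u) = `|a| * norm1 u.
Proof. by rewrite /norm1 mulr_sumr; apply: eq_bigr => i _;
  rewrite mxE normrM. Qed.

Lemma norm2_le_norm1 n (u : 'cV[R]_n) : norm2 u <= norm1 u.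
Proof.
have {1}-> : u = \sum_i u i 0 *: delta_mx i 0.
  by rewrite [LHS]matrix_sum_delta; apply: eq_bigr => i _; rewrite big_ord1.
rewrite /norm1; elim/big_rec2: _ => [|i x y _ xy]; first by rewrite norm20.
apply: le_trans (norm2D _ _) _; apply: lerD => //.
by rewrite norm2Z norm2_delta mulr1.
Qed.

Lemma norm2_mulmx_bounded p q (A : 'M[R]_(p, q)) :
  exists2 C, 0 <= C & forall u, norm2 (A *m u) <= C * norm2 u.
Proof.
exists (\sum_i norm2 (row i A)^T) => [|u]; first by apply: sumr_ge0 => i _;
  exact: norm2_ge0.
apply: le_trans (norm2_le_norm1 _) _;
  rewrite /norm1 mulr_suml ler_sum // => i _.
suff -> : (A *m u) i 0 = dot (row i A)^T u by exact: cauchy_schwarz.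
by rewrite /dot trmxK -row_mul [RHS]mxE.
Qed.

(** The supremum that defines the spectral norm is a number because some bound of
    this shape exists; without it [sup] would be a default value. *)
Lemma norm2_mulmx p q (A : 'M[R]_(p, q)) (u : 'cV[R]_q) :
  norm2 (A *m u) <= spectral_norm A * norm2 u.
Proof.
have [C C0 AC] := norm2_mulmx_bounded A.
have [->|u0] := eqVneq u 0; first by rewrite mulmx0 !norm20 mulr0.
have up : 0 < norm2 u by rewrite lt_neqAle eq_sym norm2_eq0 u0 norm2_ge0.
rewrite -ler_pdivrMr // -[X in X <= _](_ :
    norm2 (A *m ((norm2 u)^-1 *: u)) = _); last first.
  by rewrite -scalemxAr norm2Z ger0_norm ?invr_ge0 ?norm2_ge0 // mulrC.
apply: sup_upper_bound.
  split; first by exists (norm2 (A *m 0)), 0 => //=; rewrite norm20.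
  exists C => _ [v /= v1 <-]; apply: le_trans (AC v) _.
  by rewrite -[leRHS]mulr1 ler_wpM2l.
exists ((norm2 u)^-1 *: u) => //=.
by rewrite norm2Z ger0_norm ?invr_ge0 ?norm2_ge0 // mulVf ?gt_eqF.
Qed.

(** * Topology of matrices *)

Lemma mx_entry_le_norm p q (A : 'M[R]_(p, q)) i j : `|A i j| <= `|A|.
Proof.
rewrite -[leRHS]/(mx_norm A) mx_normrE.
by apply: (le_bigmax _ (fun ij : 'I_p * 'I_q => `|A ij.1 ij.2|) (i, j)).
Qed.

Lemma mx_norm_le p q (A : 'M[R]_(p, q)) e :
  0 <= e -> (forall i j, `|A i j| <= e) -> `|A| <= e.
Proof.
move=> e0 Ae; rewrite -[leLHS]/(mx_norm A) mx_normrE.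
by apply/bigmax_leP; split=> // -[i j] _; exact: Ae.
Qed.

Lemma mx_norm_le_norm2 n (u : 'cV[R]_n) : `|u| <= norm2 u.
Proof.
by apply: mx_norm_le => [|i j]; rewrite ?norm2_ge0 // ord1 coord_le_norm2.
Qed.

Lemma norm2_le_mx_norm n (u : 'cV[R]_n) : norm2 u <= n%:R * `|u|.
Proof.
apply: le_trans (norm2_le_norm1 _) _.
apply: le_trans (_ : \sum_(i < n) `|u| <= _).
  by apply: ler_sum => i _; exact: mx_entry_le_norm.
by rewrite sumr_const card_ord mulr_natl.
Qed.

Lemma mx_cvgP T (F : set_system T) {FF : Filter F} p q (f :
    T -> 'M[R]_(p, q)) (M : 'M[R]_(p, q)) :
  f @ F --> M <-> forall i j, f t i j @[t --> F] --> M i j.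
Proof.
split=> [fM i j|fM].
  by apply: (cvg_comp _ (fun N : 'M[R]_(p, q) => N i j) fM);
    exact: coord_continuous.
apply/cvgrPdist_le => e e0.
have {}fM (ij : 'I_p * 'I_q) : \forall t \near F, `|(M - f t) ij.1 ij.2| <= e.
  by move/cvgrPdist_le: (fM ij.1 ij.2) => /(_ _ e0); apply: filterS => t;
    rewrite !mxE.
have {}fM := filter_forall (f := fun ij t => `|(M - f t) ij.1 ij.2| <= e) FF fM.
near=> t; have ft := near fM t.
by apply: mx_norm_le => [|i j]; [exact: ltW|apply: (ft _ (i, j)) => //].
Unshelve. all: by end_near. Qed.

Lemma cvg_norm2P T (F : set_system T) {FF : Filter F} n (f : T -> 'cV[R]_n) (v :
    'cV[R]_n) :
  f @ F --> v <-> norm2 (f t - v) @[t --> F] --> 0.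
Proof.
split=> [fv|fv].
  have : n%:R * `|f t - v| @[t --> F] --> n%:R * (0 : R).
    by apply: cvgMr; rewrite -(@normr0 _ 'cV[R]_n); apply: cvg_norm;
      exact/subr_cvg0.
  rewrite mulr0; apply: squeeze_cvgr; last exact: cvg_cst.
  by apply: nearW => t; rewrite norm2_ge0 norm2_le_mx_norm.
apply/subr_cvg0/norm_cvg0P; apply: squeeze_cvgr (cvg_cst 0) fv.
by apply: nearW => t; rewrite normr_ge0 mx_norm_le_norm2.
Qed.

Lemma cvg_sumr T (F : set_system T) {FF : Filter F} n (f : 'I_n -> T -> R) (a :
    'I_n -> R) :
  (forall i, f i @ F --> a i) -> \sum_i f i t @[t --> F] --> \sum_i a i.
Proof. by move=> fa; apply: cvg_big => //; exact: add_continuous. Qed.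

Lemma cvg_mulmx T (F : set_system T) {FF : Filter F} p q r
    (f : T -> 'M[R]_(p, q)) (g : T -> 'M[R]_(q, r)) (M : 'M[R]_(p, q)) (N :
      'M[R]_(q, r)) :
  f @ F --> M -> g @ F --> N -> f t *m g t @[t --> F] --> M *m N.
Proof.
move=> /mx_cvgP fM /mx_cvgP gN; apply/mx_cvgP => i j.
under eq_fun do rewrite mxE; rewrite mxE.
by apply: cvg_sumr => k; apply: cvgM.
Qed.

Lemma cvg_trmx T (F : set_system T) {FF : Filter F} p q (f :
    T -> 'M[R]_(p, q)) (M : 'M[R]_(p, q)) :
  f @ F --> M -> (f t)^T @[t --> F] --> M^T.
Proof.
move=> /mx_cvgP fM; apply/mx_cvgP => i j.
by under eq_fun do rewrite mxE; rewrite mxE; exact: fM.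
Qed.

Lemma cvg_dot T (F : set_system T) {FF : Filter F} n (f g : T -> 'cV[R]_n) (u v :
    'cV[R]_n) :
  f @ F --> u -> g @ F --> v -> dot (f t) (g t) @[t --> F] --> dot u v.
Proof.
move=> fu gv.
have /mx_cvgP : (f t)^T *m g t @[t --> F] --> u^T *m v by apply: cvg_mulmx => //;
    exact: cvg_trmx.
exact.
Qed.

Lemma cvg_norm1 T (F : set_system T) {FF : Filter F} n (f : T -> 'cV[R]_n) (u :
    'cV[R]_n) :
  f @ F --> u -> norm1 (f t) @[t --> F] --> norm1 u.
Proof. by move=> /mx_cvgP fu; apply: cvg_sumr => i; apply: cvg_norm. Qed.

Lemma cvg_norm2 T (F : set_system T) {FF : Filter F} n (f : T -> 'cV[R]_n) (u :
    'cV[R]_n) :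
  f @ F --> u -> norm2 (f t) @[t --> F] --> norm2 u.
Proof.
move=> fu; rewrite norm2E; under eq_fun do rewrite norm2E.
by apply: (cvg_comp _ Num.sqrt (cvg_dot fu fu)); exact: sqrt_continuous.
Qed.

Lemma norm2_continuous n : continuous (@norm2 R n).
Proof. by move=> u; apply: (@cvg_norm2 _ (nbhs u) _ n id u); exact: cvg_id. Qed.

Lemma closed_ball2_compact n (v : 'cV[R]_n) r :
  compact [set u : 'cV[R]_n | norm2 (u - v) <= r].
Proof.
have cB : compact [set w : 'rV[R]_n | norm2 (w^T - v) <= r].
  apply: bounded_closed_compact.
    exists (r + norm2 v); split; first exact: num_real.
    move=> x xr w /= wr; apply: le_trans (ltW xr).
    apply: mx_norm_le => [|i j];
      first by rewrite addr_ge0 ?norm2_ge0 // (le_trans _ wr) ?norm2_ge0.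
    rewrite ord1 -[w]trmxK mxE; apply: le_trans (coord_le_norm2 _ _) _.
    by rewrite -[w^T](subrK v); apply: le_trans (norm2D _ _) _; rewrite lerD2r.
  apply: (@closed_comp _ _ (fun w :
      'rV[R]_n => norm2 (w^T - v)) [set x | x <= r]); last exact: closed_le.
  move=> w _; apply: (@cvg_norm2 _ (nbhs w) _ n (fun w => w^T - v) (w^T - v)).
  by apply: cvgB; [apply: cvg_trmx; exact: cvg_id|exact: cvg_cst].
have := continuous_compact (f := @trmx R 1 n) _ cB.
have -> : (@trmx R 1 n) @` [set w : 'rV[R]_n | norm2 (w^T - v) <= r] =
    [set u : 'cV[R]_n | norm2 (u - v) <= r].
  apply/seteqP; split=> [_ [w wr <-] //|u ur].
  by exists u^T; rewrite /= ?trmxK.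
apply; apply: continuous_subspaceT => w.
by apply: (@cvg_trmx _ (nbhs w) _ 1 n id w); exact: cvg_id.
Qed.

(** Bolzano-Weierstrass. *)
Lemma bounded_subsequence n (x : nat -> 'cV[R]_n) v r :
  (\forall k \near \oo, norm2 (x k - v) <= r) ->
  exists (s : nat -> nat) (l : 'cV[R]_n),
    (forall j, (j <= s j)%N) /\ x (s j) @[j --> \oo] --> l.
Proof.
move=> xr;
  have [l [_ xl]] : [set u : 'cV[R]_n | norm2 (u - v) <= r] `&` cluster (x @ \oo)
      !=set0.
  exact: closed_ball2_compact.
have ex j : exists k, (j <= k)%N /\ `|l - x k| < j.+1%:R^-1.
  have Fj : (x @ \oo) (x @` [set k | (j <= k)%N]).
    by exists j => // k /= jk; exists k.
  have Bj : nbhs l (ball l (j.+1%:R^-1)) by apply: nbhsx_ballx;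
    rewrite invr_gt0.
  have [_ [[k jk <-]]] := xl _ _ Fj Bj.
  by rewrite -ball_normE /= => lk; exists k.
have [s hs] := choice ex.
exists s, l; split=> [j|]; first by have [] := hs j.
apply/cvgrPdist_le => e e0.
have := @cvg_harmonic R; move/cvgrPdist_le => /(_ _ e0).
apply: filterS => j /=; rewrite sub0r normrN ger0_norm ?invr_ge0 // => je.
by apply: le_trans je; apply/ltW; have [] := hs j.
Qed.

(** * Smallest singular value *)

(** At [u - t z] with [z = B u] the form is [- 2 t |z|^2 + O(t^2)], which is
    negative for small [t > 0] unless [z = 0]. *)
Lemma psd_kernel n (B : 'M[R]_n) (u : 'cV[R]_n) :
  B^T = B -> (forall v, 0 <= dot v (B *m v)) -> dot u (B *m u) = 0 -> B *m u = 0.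
Proof.
move=> Bsym Bpos Bu; set z := B *m u.
have zBu : dot u (B *m z) = dot z z by rewrite dot_adjoint Bsym.
apply: dot_eq0; set c := dot z (B *m z); have c0 : 0 <= c by exact: Bpos.
set a := dot z z; have a0 : 0 <= a by exact: dot_ge0.
(* any t with t * c < 2 * a would do; t * (c + 1) = a is convenient *)
have := Bpos (u - (a / (c + 1)) *: z).
rewrite mulmxBr -scalemxAr dotBl !dotBr !dotZl !dotZr Bu zBu -/z -/a -/c.
set t := a / (c + 1) => h.
have c1 : 0 < c + 1 by lra.
have t0 : 0 <= t by rewrite /t divr_ge0 // ltW.
have ta : t * (c + 1) = a by rewrite /t divfK ?gt_eqF.
have {}h : 0 <= t * (t * c - 2 * a) by lra.
have [t00|tn0] := eqVneq t 0; first by rewrite -ta t00 mul0r.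
have tp : 0 < t by rewrite lt_neqAle eq_sym tn0.
move: h; rewrite pmulr_rge0 // -ta => h.
exfalso; clearbody t c; clear - tp c0 h; nra.
Qed.

(** The minimum of the Rayleigh quotient of [A A^T] over the compact unit sphere
    is an eigenvalue: the form [A A^T - l I] is positive semidefinite and
    vanishes at a minimiser, which is therefore in its kernel. *)
Lemma singular_value_lower_bound p q (A : 'M[R]_(p, q)) (s0 : R) (y : 'cV[R]_p) :
  0 < s0 -> (forall s, singular_value A s -> s0 <= s) ->
  s0 * norm2 y <= norm2 (A^T *m y).
Proof.
move=> s00 As.
have [->|yn0] := eqVneq y 0; first by rewrite mulmx0 !norm20 mulr0.
have yp : 0 < norm2 y by rewrite lt_neqAle eq_sym norm2_eq0 yn0 norm2_ge0.
pose S := [set u : 'cV[R]_p | norm2 u = 1].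
have cS : compact S.
  have -> : S = [set u : 'cV[R]_p | norm2 (u - 0) <= 1] `&` S.
    by apply/seteqP; split=> [u /= u1|u []//]; split=> //=; rewrite subr0 u1.
  apply: compact_closedI; first exact: closed_ball2_compact.
  apply: (@closed_comp _ _ (@norm2 R p) [set x | x = 1]); last exact: closed_eq.
  by move=> u _; exact: norm2_continuous.
pose q2 (u : 'cV[R]_p) := dot u (A *m A^T *m u).
have S0 : S !=set0.
  exists ((norm2 y)^-1 *: y).
  by rewrite /S /= norm2Z ger0_norm ?invr_ge0 ?norm2_ge0 // mulVf ?gt_eqF.
have [|u0 + u0min] := compact_EVT_min (f := q2) S0 cS.
  apply: continuous_subspaceT => u;
    apply: (@cvg_dot _ (nbhs u) _ p id (fun u => A *m A^T *m u) u).
    exact: cvg_id.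
  by apply: (@cvg_mulmx _ (nbhs u) _ p p 1 (fun=> A *m A^T) id _ u);
    [exact: cvg_cst|exact: cvg_id].
rewrite inE => u0S; have u01 : norm2 u0 = 1 by []; set l := q2 u0 in u0min.
have q2E u : q2 u = norm2 (A^T *m u) ^+ 2.
  by rewrite norm2_sqr /q2 -mulmxA dot_adjoint.
have l0 : 0 <= l by rewrite /l q2E sqr_ge0.
have ray u : l * norm2 u ^+ 2 <= q2 u.
  have [->|un0] := eqVneq u 0;
    first by rewrite norm20 expr0n mulr0 q2E mulmx0 norm20 expr0n.
  have up : 0 < norm2 u by rewrite lt_neqAle eq_sym norm2_eq0 un0 norm2_ge0.
  have uS : (norm2 u)^-1 *: u \in S.
    by rewrite inE /S /= norm2Z ger0_norm ?invr_ge0 ?norm2_ge0 // mulVf ?gt_eqF.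
  rewrite -ler_pdivlMr ?exprn_gt0 //.
  apply: le_trans (u0min _ uS) _.
  rewrite !q2E -scalemxAr norm2Z exprMn ger0_norm ?invr_ge0 ?norm2_ge0 //.
  by rewrite exprVn mulrC.
pose B := A *m A^T - l%:M.
have Bu v : B *m v = A *m A^T *m v - l *: v by rewrite mulmxBl mul_scalar_mx.
have /eqP : B *m u0 = 0.
  apply: psd_kernel.
  - by rewrite linearB /= trmx_mul trmxK tr_scalar_mx.
  - by move=> v; rewrite Bu dotBr dotZr -norm2_sqr subr_ge0 ray.
  - by rewrite Bu dotBr dotZr -norm2_sqr u01 expr1n mulr1 -/(q2 u0) subrr.
rewrite Bu subr_eq0 => /eqP eig.
have : singular_value A (Num.sqrt l).
  split; first exact: sqrtr_ge0.
  rewrite sqr_sqrtr //; apply/eigenvalueP; exists u0^T.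
    by have := congr1 trmx eig; rewrite !trmx_mul !trmxK linearZ.
  apply/eqP => /(congr1 trmx); rewrite trmxK trmx0 => u00.
  by move: u01; rewrite u00 norm20 => /eqP; rewrite eq_sym oner_eq0.
move/As => s0l; have s0ge0 := ltW s00.
rewrite -(@ler_pXn2r _ 2) ?nnegrE ?norm2_ge0 ?mulr_ge0 ?norm2_ge0 //.
rewrite -q2E; apply: le_trans (ray y); rewrite exprMn ler_wpM2r ?sqr_ge0 //.
by rewrite -(sqr_sqrtr l0) ler_pXn2r // nnegrE ?sqrtr_ge0 // ltW.
Qed.

End Euclidean.

(** * The Newton system *)

Section NewtonSystem.
Context {R : realType}.

Lemma injective_unitmx n (M : 'M[R]_n) :
  (forall u : 'cV[R]_n, M *m u = 0 -> u = 0) -> M \in unitmx.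
Proof.
move=> Minj; rewrite -unitmx_tr -row_free_unit -kermx_eq0.
apply/eqP/row_matrixP => i; rewrite row0; apply: trmx_inj; rewrite trmx0.
apply: Minj; rewrite -{1}[M]trmxK -trmx_mul -row_mul mulmx_ker row0.
exact: trmx0.
Qed.

Lemma newton_systemE n m (h : 'M[R]_n) (J : 'M[R]_(n, m)) g c d y :
  solves_newton_system h J g c d y <-> h *m d + J *m y = - g /\ J^T *m d = - c.
Proof.
rewrite /solves_newton_system mul_block_col opp_col_mx mul0mx addr0.
by split=> [/eq_col_mx//|[-> ->]].
Qed.

End NewtonSystem.

Section RangeAndNullSpace.
Context {R : realType} {n m : nat} (J : 'M[R]_(n, m)) (s0 : R).
Hypothesis s0_gt0 : 0 < s0.
Hypothesis J_bounded_below : forall y, s0 * norm2 y <= norm2 (J *m y).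

Lemma jacobian_injective (y : 'cV[R]_m) : J *m y = 0 -> y = 0.
Proof.
move=> Jy; have := J_bounded_below y; rewrite Jy norm20 pmulr_rle0 // => y0.
by apply/eqP; rewrite -norm2_eq0 eq_le y0 norm2_ge0.
Qed.

Lemma gram_unit : J^T *m J \in unitmx.
Proof.
apply: injective_unitmx => y; rewrite -mulmxA => JJy; apply: jacobian_injective.
by apply: dot_eq0; rewrite dot_adjoint JJy dot0l.
Qed.

(** Orthogonal projection onto the range of [J]. *)
Lemma range_projection (g : 'cV[R]_n) : exists y : 'cV[R]_m, J^T *m (g - J *m y) = 0.
Proof.
exists (invmx (J^T *m J) *m (J^T *m g)).
by rewrite mulmxBr !mulmxA mulmxV ?gram_unit // mul1mx subrr.
Qed.

Lemma orthogonal_null_range (g : 'cV[R]_n) :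
  (forall u : 'cV[R]_n, J^T *m u = 0 -> dot u g = 0) -> exists y : 'cV[R]_m, g = J *m y.
Proof.
move=> g0; have [y Jy] := range_projection g; exists y.
apply/eqP; rewrite -subr_eq0; apply/eqP/dot_eq0.
by rewrite dotBr g0 // dot_adjoint Jy dot0l subrr.
Qed.

(** Orthogonal decomposition along the null space of [J^T] and the range of [J];
    the second component is controlled by [J^T d] alone. *)
Lemma null_range_split (d : 'cV[R]_n) : exists u v : 'cV[R]_n,
  [/\ d = u + v, J^T *m u = 0, (forall y : 'cV[R]_m, dot u (J *m y) = 0),
      dot u v = 0 & s0 * norm2 v <= norm2 (J^T *m d)].
Proof.
have [w Jw] := range_projection d; set u := d - J *m w in Jw.
have uJ y : dot u (J *m y) = 0 by rewrite dot_adjoint Jw dot0l.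
exists u, (J *m w); split => //; first by rewrite subrK.
have [v0|v0] := eqVneq (norm2 (J *m w)) 0; first by rewrite v0 mulr0 norm2_ge0.
have vp : 0 < norm2 (J *m w) by rewrite lt_neqAle eq_sym v0 norm2_ge0.
rewrite -(ler_pM2r vp) -mulrA -expr2 norm2_sqr.
have -> : dot (J *m w) (J *m w) = dot w (J^T *m d).
  by rewrite -[d](subrK (J *m w)) -/u mulmxDr Jw add0r [RHS]dot_adjoint trmxK.
apply: le_trans (_ : s0 * (norm2 w * norm2 (J^T *m d)) <= _).
  by rewrite ler_pM2l //; apply: le_trans (cauchy_schwarz _ _); exact: ler_norm.
by rewrite mulrA mulrC ler_wpM2l ?norm2_ge0.
Qed.

End RangeAndNullSpace.

(** The uniform bounds under which the Newton matrix is invertible, with bounds on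
    the solution that depend on [kappa], [zeta] and [s0] only. *)
Record regular_newton {R : realType} {n m : nat} (h : 'M[R]_n)
    (J : 'M[R]_(n, m)) (kappa zeta s0 : R) : Prop := RegularNewton {
  rn_sym : h^T = h ;
  rn_kappa : 0 < kappa ;
  rn_zeta : 0 < zeta ;
  rn_s0 : 0 < s0 ;
  rn_bounded : forall u, norm2 (h *m u) <= kappa * norm2 u ;
  rn_coercive : forall u,
    J^T *m u = 0 -> zeta * norm2 u ^+ 2 <= dot u (h *m u) ;
  rn_below : forall y, s0 * norm2 y <= norm2 (J *m y)
}.

Section RegularNewton.
Context {R : realType} {n m : nat} (h : 'M[R]_n) (J : 'M[R]_(n, m))
        (kappa zeta s0 : R).
Hypothesis reg : regular_newton h J kappa zeta s0.

Let h_sym : h^T = h. Proof. by case: reg. Qed.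
Let kappa_gt0 : 0 < kappa. Proof. by case: reg. Qed.
Let zeta_gt0 : 0 < zeta. Proof. by case: reg. Qed.
Let s0_gt0 : 0 < s0. Proof. by case: reg. Qed.
Let h_bounded u : norm2 (h *m u) <= kappa * norm2 u.
Proof. by case: reg. Qed.
Let h_coercive u : J^T *m u = 0 -> zeta * norm2 u ^+ 2 <= dot u (h *m u).
Proof. exact: (rn_coercive reg). Qed.
Let J_bounded_below y : s0 * norm2 y <= norm2 (J *m y).
Proof. by case: reg. Qed.

Lemma dot_h_le u v : `|dot u (h *m v)| <= kappa * (norm2 u * norm2 v).
Proof.
apply: le_trans (cauchy_schwarz _ _) _; rewrite mulrCA.
by rewrite ler_wpM2l ?norm2_ge0.
Qed.

(** With [d = u + v] split along null space and range: [2 / zeta] converts curvature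
    into [|u|^2];
      the fraction over [s0^2] collects [|v|^2] and the cross terms. *)
Definition curvature_constant : R :=
  2 / zeta + (2 / zeta * (kappa + 2 * kappa ^+ 2 / zeta) + 1) / s0 ^+ 2.

Lemma curvature_constant_gt0 : 0 < curvature_constant.
Proof.
have := kappa_gt0; have := zeta_gt0; have := s0_gt0 => *.
rewrite /curvature_constant; apply: addr_gt0; first exact: divr_gt0.
apply: divr_gt0; last exact: exprn_gt0.
apply: addr_gt0 => //; apply: mulr_gt0; first exact: divr_gt0.
by apply: addr_gt0 => //; apply: divr_gt0 => //; rewrite mulr_gt0 ?exprn_gt0.
Qed.

(** Splitting [d] along null space and range, the cross terms are absorbed by
    Young's inequality into the coercive null-space part. *)
Lemma curvature_bound d :
  norm2 d ^+ 2 <=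
  curvature_constant * (Num.max (dot d (h *m d)) 0 + norm2 (J^T *m d) ^+ 2).
Proof.
have [u [v [dE Ju _ uv bv]]] := null_range_split s0_gt0 J_bounded_below d.
have nd : norm2 d ^+ 2 = norm2 u ^+ 2 + norm2 v ^+ 2.
  by rewrite !norm2_sqr dE dotDl !dotDr [dot v u]dotC uv addr0 add0r.
have dHd : dot d (h *m d) = dot u (h *m u) + 2 * dot u (h *m v) + dot v (h *m v).
  rewrite dE mulmxDr dotDl !dotDr (_ : dot v (h *m u) = dot u (h *m v));
    first ring.
  by rewrite dot_adjoint h_sym dotC.
have hu := h_coercive Ju.
have huv : - (kappa * (norm2 u * norm2 v)) <= dot u (h *m v).
  by have := dot_h_le u v; rewrite ler_norml => /andP[].
have hvv : - (kappa * (norm2 v * norm2 v)) <= dot v (h *m v).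
  by have := dot_h_le v v; rewrite ler_norml => /andP[].
have Mge : dot d (h *m d) <= Num.max (dot d (h *m d)) 0 by rewrite le_max lexx.
have M0 : 0 <= Num.max (dot d (h *m d)) 0 by rewrite le_max lexx orbT.
rewrite nd; move: Mge M0; set M := Num.max _ _ => Mge M0.
set e := norm2 (J^T *m d) in bv *.
have e0 : 0 <= e by exact: norm2_ge0.
have a0 := norm2_ge0 u; have b0 := norm2_ge0 v.
move: nd dHd hu huv hvv a0 b0 bv Mge.
move: (dot d _) (dot u (h *m u)) (dot u (h *m v)) (dot v _) (norm2 u) (norm2 v).
move=> D Suu Suv Svv a b _ -> hu huv hvv a0 b0 bv Mge.
have young : 2 * (kappa * (a * b)) <= zeta / 2 * a ^+ 2 +
    2 * kappa ^+ 2 / zeta * b ^+ 2.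
  rewrite -subr_ge0 (_ : _ - _ = (zeta / 2) * (a - 2 * kappa / zeta * b) ^+ 2).
    by rewrite mulr_ge0 ?sqr_ge0 // divr_ge0 // ltW.
  by field; rewrite gt_eqF.
have b2 : b ^+ 2 <= e ^+ 2 / s0 ^+ 2.
  rewrite ler_pdivlMr ?exprn_gt0 // -exprMn mulrC.
  by rewrite ler_pXn2r // nnegrE // mulr_ge0 // ltW.
have a2 : a ^+ 2 <= 2 / zeta * (M + (kappa + 2 * kappa ^+ 2 / zeta) * b ^+ 2).
  rewrite mulrAC ler_pdivlMr //.
  set k2 := 2 * kappa ^+ 2 / zeta in young *.
  move: young; rewrite -/k2; nra.
set k3 := kappa + 2 * kappa ^+ 2 / zeta in a2 *.
have k30 : 0 <= k3 by rewrite /k3 addr_ge0 // ?divr_ge0 // ?mulr_ge0 //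
    ?exprn_ge0 // ltW.
have z0 : 0 <= 2 / zeta by rewrite divr_ge0 // ltW.
rewrite /curvature_constant -/k3.
apply: le_trans (_ : 2 / zeta * M + (2 / zeta * k3 + 1) * (e ^+ 2 / s0 ^+ 2) <= _).
  apply: le_trans (_ : 2 / zeta * M + (2 / zeta * k3 + 1) * b ^+ 2 <= _).
    move: a2; lra.
  by rewrite lerD2l ler_wpM2l // addr_ge0 // mulr_ge0.
set P := 2 / zeta * k3 + 1; set z := 2 / zeta in z0 *.
have P0 : 0 <= P / s0 ^+ 2.
  by rewrite divr_ge0 ?exprn_ge0 ?(ltW s0_gt0) // addr_ge0 // mulr_ge0.
have -> : P * (e ^+ 2 / s0 ^+ 2) =
    P / s0 ^+ 2 * e ^+ 2 by rewrite [e ^+ 2 / _]mulrC mulrA.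
have : 0 <= z * e ^+ 2 by rewrite mulr_ge0 // exprn_ge0.
have : 0 <= P / s0 ^+ 2 * M by rewrite mulr_ge0.
lra.
Qed.

(** On the null space the system reads [u.(h d) = - u.g], which bounds the
    null-space part by coercivity; the range part is fixed by the second
    block row. *)
Lemma newton_direction_bound g c d y :
  solves_newton_system h J g c d y ->
  norm2 d <= norm2 g / zeta + (kappa / zeta + 1) / s0 * norm2 c.
Proof.
move=> /newton_systemE[hd Jd].
have [u [v [dE Ju uJ uv bv]]] := null_range_split s0_gt0 J_bounded_below d.
rewrite Jd norm2N in bv.
have uhd : dot u (h *m u) = - dot u g - dot u (h *m v).
  have : dot u (h *m d + J *m y) = - dot u g by rewrite hd dotNr.
  by rewrite dotDr uJ addr0 dE mulmxDr dotDr => <-; rewrite addrK.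
have ua : zeta * norm2 u <= norm2 g + kappa * norm2 v.
  have [->|u0] := eqVneq u 0.
    by rewrite norm20 mulr0 addr_ge0 ?norm2_ge0 // mulr_ge0 ?norm2_ge0 // ltW.
  have up : 0 < norm2 u by rewrite lt_neqAle eq_sym norm2_eq0 u0 norm2_ge0.
  rewrite -(ler_pM2r up) -mulrA -expr2; apply: le_trans (h_coercive Ju) _.
  rewrite uhd mulrDl lerD //.
    by rewrite -dotNr; apply: le_trans (ler_norm _) _;
      rewrite mulrC -(norm2N g) cauchy_schwarz.
  by rewrite -dotNr -mulmxN; apply: le_trans (ler_norm _) _;
    apply: le_trans (dot_h_le _ _) _; rewrite norm2N mulrCA mulrC.
have {}ua : norm2 u <= norm2 g / zeta + kappa / zeta * norm2 v.
  by rewrite [_ / zeta * _]mulrAC -mulrDl ler_pdivlMr // mulrC.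
have {}bv : norm2 v <= norm2 c / s0 by rewrite ler_pdivlMr // mulrC.
rewrite dE; apply: le_trans (norm2D _ _) _.
apply: le_trans (lerD ua (lexx _)) _;
  rewrite -addrA lerD2l -{2}[norm2 v]mul1r -mulrDl.
by rewrite -mulrA [s0^-1 * _]mulrC ler_wpM2l // addr_ge0 // divr_ge0 ?(ltW
    kappa_gt0) ?(ltW zeta_gt0).
Qed.

(** [J y = - g - h d], and [J] is bounded below. *)
Lemma newton_multiplier_bound g c d y :
  solves_newton_system h J g c d y ->
  s0 * norm2 y <= norm2 g + kappa * norm2 d.
Proof.
move=> /newton_systemE[hd _]; apply: le_trans (J_bounded_below y) _.
have -> : J *m y = - g - h *m d by rewrite -hd addrC addKr.
by apply: le_trans (norm2B _ _) _; rewrite norm2N lerD2l.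
Qed.

Lemma newton_matrix_unit : block_mx h J J^T 0 \in unitmx.
Proof.
apply: injective_unitmx => w; rewrite -[w]vsubmxK.
set d := usubmx w; set y := dsubmx w => K0.
have hs : solves_newton_system h J 0 0 d y.
  by rewrite /solves_newton_system K0 col_mx0 oppr0.
have := newton_direction_bound hs; rewrite !norm20 mul0r mulr0 addr0 => d0.
have {}d0 : d = 0 by apply/eqP; rewrite -norm2_eq0 eq_le d0 norm2_ge0.
have /newton_systemE[] := hs.
rewrite d0 mulmx0 add0r oppr0 => /(jacobian_injective s0_gt0 J_bounded_below) -> _.
by rewrite col_mx0.
Qed.

(** The primal part of the solution of the system with right-hand side
    [(g, 0)]; by symmetry of the matrix it represents the functional
    [d |-> g.d] in terms of the data that produced [d]. *)
Definition adjoint_direction (g : 'cV[R]_n) : 'cV[R]_n :=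
  usubmx (invmx (block_mx h J J^T 0) *m (col_mx g 0 : 'cV[R]_(n + m))).

Lemma adjoint_direction_bound g : norm2 (adjoint_direction g) <= norm2 g / zeta.
Proof.
set w := invmx (block_mx h J J^T 0) *m (col_mx g 0 : 'cV[R]_(n + m)).
have : solves_newton_system h J (- g) 0 (usubmx w) (dsubmx w).
  rewrite /solves_newton_system vsubmxK /w mulmxA mulmxV ?newton_matrix_unit //.
  by rewrite mul1mx opp_col_mx opprK oppr0.
by move/newton_direction_bound; rewrite norm20 mulr0 addr0 norm2N.
Qed.

Lemma newton_difference g1 g2 c d1 y1 d2 y2 :
  solves_newton_system h J g1 c d1 y1 -> solves_newton_system h J g2 c d2 y2 ->
  solves_newton_system h J (g1 - g2) 0 (d1 - d2) (y1 - y2).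
Proof.
move=> /newton_systemE[a1 b1] /newton_systemE[a2 b2]; apply/newton_systemE;
  split.
  by rewrite !mulmxBr addrACA a1 -opprD a2 opprK opprB addrC.
by rewrite mulmxBr b1 b2 subrr oppr0.
Qed.

(** Both sides are the scalar product of the two solutions taken through the
    symmetric matrix: moving the matrix from one factor to the other replaces the
    unknown [d1 - d2] by the data [g1 - g2]. *)
Lemma adjoint_direction_dot g g1 g2 c d1 y1 d2 y2 :
  solves_newton_system h J g1 c d1 y1 -> solves_newton_system h J g2 c d2 y2 ->
  dot g (d1 - d2) = - dot (adjoint_direction g) (g1 - g2).
Proof.
move=> s1 s2; have := newton_difference s1 s2; rewrite /solves_newton_system.
set K := block_mx _ _ _ _; set w := col_mx _ (y1 - y2) => Kw.
have Ksym : K^T = K by rewrite /K tr_block_mx trmxK h_sym trmx0.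
have dot_col (a b : 'cV[R]_n) (a' b' : 'cV[R]_m) :
    dot (col_mx a a') (col_mx b b') = dot a b + dot a' b'.
  by rewrite /dot tr_col_mx mul_row_col mxE.
have -> : dot g (d1 - d2) = dot (col_mx g 0) w by rewrite dot_col dot0l addr0.
have {1}-> : col_mx g 0 = K *m (invmx K *m col_mx g (0 : 'cV[R]_m)).
  by rewrite mulmxA mulmxV ?newton_matrix_unit // mul1mx.
rewrite -{1}Ksym -dot_adjoint Kw dotNr; congr (- _).
by rewrite -[X in dot X _]vsubmxK dot_col dot0r addr0.
Qed.

End RegularNewton.

(** * Mean value bounds *)

Section Calculus.
Context {R : realType} {n : nat}.
Implicit Types (f : 'cV[R]_n -> R) (x y v : 'cV[R]_n).

Lemma derive_gradient f x v :
  differentiable (f : 'cV[R]_n -> R^o) x ->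
  'D_v (f : 'cV[R]_n -> R^o) x = dot (gradient f x) v.
Proof.
move=> df; rewrite deriveE // {1}(matrix_sum_delta v) linear_sum dotE.
apply: eq_bigr => i _; rewrite big_ord1 linearZ /= mxE deriveE //.
by rewrite mulrC.
Qed.

(** The difference quotients of [s |-> f (x + s v)] at [t] are those of [f] at
    [x + t v] in the direction [v]. *)
Lemma is_derive_line f x v (t : R) :
  differentiable (f : 'cV[R]_n -> R^o) (x + t *: v) ->
  is_derive t 1 (fun s => f (x + s *: v)) (dot (gradient f (x + t *: v)) v).
Proof.
move=> df;
  have dv : derivable (f : 'cV[R]_n -> R^o) (x + t *: v) v by exact: diff_derivable.
have E : (fun h : R => h^-1 *: (((fun s :
    R => f (x + s *: v)) \o shift t) (h *: (1 : R)) - f (x + t *: v) : R^o)) =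
         (fun h => h^-1 *: (((f : 'cV[R]_n -> R^o) \o shift (x +
           t *: v)) (h *: v) - f (x + t *: v))).
  apply/funext => h /=; congr (_ *: (f _ - _)).
  by rewrite [h *: 1]mulr1 scalerDl addrCA.
apply: DeriveDef.
  by rewrite /derivable; move: dv; rewrite /derivable -E.
by rewrite -derive_gradient // /derive -E.
Qed.

Lemma mean_value f x y : (forall z, differentiable (f : 'cV[R]_n -> R^o) z) ->
  exists2 t : R, 0 <= t <= 1 &
    f y - f x = dot (gradient f (x + t *: (y - x))) (y - x).
Proof.
move=> df.
have dg s := is_derive_line (df (x + s *: (y - x))).
have cg : {within `[0, 1], continuous (fun s : R => f (x + s *: (y - x)))}.
  by apply: derivable_within_continuous => s _; have [] := dg s.
have [t t01 E] := MVT_segment ler01 (fun s _ => dg s) cg.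
exists t; first by move: t01; rewrite in_itv.
by move: E; rewrite /= scale1r scale0r addr0 subr0 mulr1 subrKC.
Qed.

Lemma convex_segment (C : set 'cV[R]_n) x y (t : R) :
  convex_set (C : set (convex_lmodType 'cV[R]_n)) -> C x -> C y ->
  0 <= t <= 1 -> C (x + t *: (y - x)).
Proof.
move=> cC Cx Cy /andP[t0 t1].
have t01 : Itv.spec (Itv.num_sem (R:=R)) (Itv.Real `[0%Z, 1%Z]) t.
  by apply/and3P; rewrite /= num_real !bnd_simp t0 t1.
have := cC y x (Itv.mk t01); rewrite !inE => /(_ Cy Cx).
have -> // : x + t *: (y - x) = t *: y + (1 - t) *: x.
by rewrite scalerBl scale1r scalerBr addrA addrCA addrA.
Qed.

Lemma is_derive_coord m (c : 'cV[R]_n -> 'cV[R]_m) x v j :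
  derivable c x v -> 'D_v (fun z => c z j 0 : R^o) x = ('D_v c x) j 0.
Proof.
move=> /mx_cvgP cv; apply/cvg_lim => //.
have := cv j 0; rewrite -/('D_v c x); under eq_fun do rewrite !mxE; apply.
Qed.

Lemma differentiable_coord_fun m (c : 'cV[R]_n -> 'cV[R]_m) x j :
  differentiable c x -> differentiable (fun z => c z j 0 : R^o) x.
Proof.
move=> dc;
  apply: (@differentiable_comp _ _ _ _ c (fun u : 'cV[R]_m => u j 0 : R^o)) => //.
exact: differentiable_coord.
Qed.

Lemma gradient_coord m (c : 'cV[R]_n -> 'cV[R]_m) x j :
  differentiable c x -> gradient (fun z => c z j 0) x = col j (nabla c x).
Proof.
move=> dc; apply/matrixP => i k; rewrite !mxE is_derive_coord //.
exact: diff_derivable.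
Qed.

Context (Dom : set 'cV[R]_n).
Hypothesis Dom_convex : convex_set (Dom : set (convex_lmodType 'cV[R]_n)).

Lemma segment_le x v (t : R) : 0 <= t <= 1 -> norm2 (x + t *: v - x) <= norm2 v.
Proof.
move=> /andP[t0 t1]; rewrite addrAC subrr add0r norm2Z ger0_norm //.
by rewrite -[leRHS]mul1r ler_wpM2r ?norm2_ge0.
Qed.

(** The mean value form gives the constant [L] instead of [L / 2]; the second-order
    terms need only be summable. *)
Lemma scalar_taylor f (L : R) x y :
  0 <= L -> (forall z, differentiable (f : 'cV[R]_n -> R^o) z) ->
  (forall x y, Dom x -> Dom y ->
     norm2 (gradient f x - gradient f y) <= L * norm2 (x - y)) ->
  Dom x -> Dom y ->
  `|f y - f x - dot (gradient f x) (y - x)| <= L * norm2 (y - x) ^+ 2.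
Proof.
move=> L0 df gL Dx Dy; have [t t01 ->] := mean_value x y df.
rewrite -dotBl; apply: le_trans (cauchy_schwarz _ _) _.
rewrite expr2 mulrA ler_wpM2r ?norm2_ge0 //.
apply: le_trans (gL _ _ (convex_segment Dom_convex Dx Dy t01) Dx) _.
by rewrite ler_wpM2l // segment_le.
Qed.

(** The mean value point depends on the component of [c], whence one error term for
    each of the [m] components. *)
Lemma vector_taylor m (c : 'cV[R]_n -> 'cV[R]_m) (L : R) x y :
  0 <= L -> (forall z, differentiable c z) ->
  (forall x y, Dom x -> Dom y ->
     spectral_norm ((nabla c x)^T - (nabla c y)^T) <= L * norm2 (x - y)) ->
  Dom x -> Dom y ->
  norm1 (c y) <= norm1 (c x + (nabla c x)^T *m (y - x))
                 + m%:R * L * norm2 (y - x) ^+ 2.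
Proof.
move=> L0 dc gL Dx Dy.
rewrite -[c y](subrKC (c x + (nabla c x)^T *m (y - x))).
apply: le_trans (norm1D _ _) _; rewrite lerD2l.
rewrite /norm1; apply: le_trans (_ : \sum_(j < m) L * norm2 (y - x) ^+ 2 <= _);
  last first.
  by rewrite sumr_const card_ord -[leLHS]mulr_natl mulrA.
apply: ler_sum => j _.
have [t t01] := mean_value x y (fun z => differentiable_coord_fun j (dc z)).
rewrite gradient_coord // => E; set z := x + t *: (y - x) in E.
have -> : (c y - (c x + (nabla c x)^T *m (y - x))) j 0 =
          (((nabla c z)^T - (nabla c x)^T) *m (y - x)) j 0.
  rewrite mulmxBl !mxE opprD addrA E /dot mxE; congr (_ - _).
  by apply: eq_bigr => i _; rewrite !mxE.
apply: le_trans (coord_le_norm2 _ _) _; apply: le_trans (norm2_mulmx _ _) _.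
rewrite expr2 mulrA ler_wpM2r ?norm2_ge0 //.
apply: le_trans (gL _ _ (convex_segment Dom_convex Dx Dy t01) Dx) _.
by rewrite ler_wpM2l // segment_le.
Qed.

End Calculus.

(** * Orthogonality to the past *)

Section Orthogonality.
Context {d : measure_display} {T : measurableType d} {R : realType}
        (P : probability T R).

Definition adapted (F : set (set T)) (Y : T -> R) : Prop :=
  measurable_fun [set: g_sigma_algebraType F] (Y : g_sigma_algebraType F -> R).

Lemma adapted_preimage (F : set (set T)) Y B :
  sigma_algebra setT F -> adapted F Y -> measurable B -> F (Y @^-1` B).
Proof.
move=> sF aY mB; have : <<s F >> (setT `&` Y @^-1` B) := aY measurableT B mB.
by rewrite setTI sigma_algebra_id.
Qed.

Lemma adapted_measurable (F : set (set T)) Y :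
  sigma_algebra setT F -> F `<=` measurable -> adapted F Y -> measurable_fun setT Y.
Proof.
by move=> sF FT aY _ B mB; rewrite setTI; apply: FT; exact: adapted_preimage.
Qed.

Lemma integrable_bounded_mul (Y W : T -> R) (B : R) :
  measurable_fun setT Y -> (forall w, `|Y w| <= B) ->
  P.-integrable setT (EFin \o W) ->
  P.-integrable setT (EFin \o (fun w => Y w * W w)).
Proof.
move=> mY YB iW.
have bY : [bounded Y x | x in [set: T]].
  exists B; split; first exact: num_real.
  by move=> x Bx w _; apply: le_trans (YB w) (ltW Bx).
exact: (@integrableMr _ _ _ P setT measurableT Y (EFin \o W) mY bY iW).
Qed.

(** A bounded [F]-measurable factor is uniformly within [1/N] of a finite
    combination of indicators of sets of [F], and each of these integrates
    [W] to zero. *)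
Lemma bounded_adapted_orthogonal (F : set (set T)) (Y W : T -> R) (B : R) :
  sigma_algebra setT F -> F `<=` measurable ->
  P.-integrable setT (EFin \o W) ->
  (forall A, F A -> \int[P]_(w in A) W w = 0) ->
  adapted F Y -> (forall w, `|Y w| <= B) ->
  \int[P]_w (Y w * W w) = 0.
Proof.
move=> sF FT iW W0 aY YB.
have mY := adapted_measurable sF FT aY.
have iYW := integrable_bounded_mul mY YB iW.
have approx (N : nat) : (0 < N)%N ->
    `|\int[P]_w (Y w * W w)| <= N%:R^-1 * \int[P]_w `|W w|.
  move=> N0; have Np : 0 < N%:R :> R by rewrite ltr0n.
  (* shifting by B makes the grid index a natural number *)
  pose u w := (Y w + B) * N%:R.
  have u0 w : 0 <= u w.
    rewrite mulr_ge0 ?ler0n //; have := YB w; rewrite ler_norml => /andP[]; lra.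
  pose k w := Num.truncn (u w).
  pose K := (Num.truncn (2 * B * N%:R)).+1.
  have kK w : (k w < K)%N.
    rewrite ltnS /k; apply: le_truncn; rewrite ler_wpM2r ?ler0n //.
    by have := YB w; rewrite ler_norml => /andP[]; lra.
  pose A (i : nat) := k @^-1` [set i].
  have FA i : F (A i).
    have -> : A i = Y @^-1` `[i%:R / N%:R - B, i.+1%:R / N%:R - B[.
      apply/seteqP; split=> w /=;
        rewrite /A /= in_itv /= lerBlDr ltrBrDr ler_pdivrMr // ltr_pdivlMr //.
        by move=> <-; exact: truncn_itv.
      by move=> /truncn_def.
    exact: adapted_preimage.
  pose S w := (k w)%:R / N%:R - B.
  have SE w : S w * W w = \sum_(i < K) (i%:R / N%:R - B) * (W \_ (A i)) w.
    rewrite (bigD1 (Ordinal (kK w))) //= big1 ?addr0 => [|i ik].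
      by rewrite patchE mem_set.
    rewrite patchE memNset ?mulr0 // => /= ki.
    by move/eqP: ik; apply; apply/val_inj.
  have mA i : measurable (A i) by apply: FT.
  have iWA i : P.-integrable setT (EFin \o (W \_ (A i))).
    have -> : EFin \o (W \_ (A i)) = (EFin \o W) \_ (A i).
      by apply/funext => w /=; rewrite !patchE; case: ifP.
    by apply/(integrable_mkcond _ (mA i)); apply: integrableS iW.
  have S0 : \int[P]_w (S w * W w) = 0.
    under eq_Rintegral do rewrite SE.
    rewrite /Rintegral; under eq_integral do rewrite -sumEFin.
    rewrite integral_sum //; last first.
      move=> i; under [X in integrable _ _ X]eq_fun do rewrite EFinM.
      exact: (integrableZl measurableT _ (iWA i)).
    rewrite big1 // => i _; under eq_integral do rewrite EFinM.
    rewrite (integralZl measurableT (iWA i)).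
    have Wi := W0 _ (FA i); rewrite Rintegral_mkcond /Rintegral in Wi.
    by rewrite -(fineK (integrable_fin_num measurableT (iWA i))) Wi mule0.
  have YS w : `|Y w - S w| <= N%:R^-1.
    have /andP[k1 k2] := truncn_itv (u0 w).
    rewrite -(ler_pM2r Np) mulVf ?gt_eqF // -{1}[N%:R]ger0_norm ?ler0n // -normrM.
    have -> : (Y w - S w) * N%:R = u w - (k w)%:R.
      by rewrite /S /u; field; rewrite gt_eqF.
    rewrite ger0_norm ?subr_ge0 // lerBlDl; apply/ltW.
    by rewrite -[1]/(1%:R) -natrD addn1.
  have mS : measurable_fun setT S.
    have -> : S = (fun w => \sum_(i < K) (i%:R / N%:R - B) * \1_(A i) w).
      apply/funext => w; rewrite (bigD1 (Ordinal (kK w))) //= big1 => [|j jk].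
        by rewrite indicE mem_set // mulr1 addr0.
      rewrite indicE memNset ?mulr0 // => /= kj.
      by move/eqP: jk; apply; apply/val_inj.
    apply: measurable_sum => j; apply: measurable_funM;
      first exact: measurable_cst.
    exact: measurable_indic.
  have SB w : `|S w| <= B + N%:R^-1.
    rewrite -[S w](subKr (Y w)); apply: le_trans (ler_normB _ _) _.
    by rewrite lerD.
  have iSW := integrable_bounded_mul mS SB iW.
  have iYSW : P.-integrable setT (EFin \o (fun w => (Y w - S w) * W w)).
    apply: (integrable_bounded_mul _ YS iW); exact: measurable_funB.
  have -> : \int[P]_w (Y w * W w) = \int[P]_w ((Y w - S w) * W w).
    rewrite -[LHS]subr0 -S0 -(RintegralB measurableT iYW iSW).
    by apply: eq_Rintegral => w _ /=; ring.
  apply: le_trans (le_normr_Rintegral _ iYSW) _ => //.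
  have iaW : P.-integrable setT (EFin \o (fun w => `|W w|)) by exact:
      (integrable_abse iW).
  rewrite -RintegralZl //; apply: le_Rintegral => //.
  - exact: (integrable_abse iYSW).
  - by under [X in integrable _ _ X]eq_fun do rewrite EFinM;
    exact: integrableZl.
  - by move=> w _; rewrite normrM ler_wpM2r.
apply/eqP; rewrite -normr_le0; apply/ler_addgt0Pl => e e0; rewrite addr0.
set I := \int[P]_w `|W w| in approx.
have I0 : 0 <= I by exact: Rintegral_ge0.
have Ie : 0 <= I / e by rewrite divr_ge0 // ltW.
apply: le_trans (approx (Num.bound (I / e)).+1 isT) _.
rewrite mulrC ler_pdivrMr // -ler_pdivrMl // mulrC.
apply: ltW; apply: lt_le_trans (archi_boundP Ie) _.
by rewrite ler_nat.
Qed.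

End Orthogonality.

(** * Measurability of continuous functions *)

Section ContinuousMeasurable.
Context {d : measure_display} {T : measurableType d} {R : realType}.

(** Preimages of open sets are countable unions of preimages of boxes with
    rational centre and radius [1/k]. *)
Lemma measurable_continuous_cV n (V : T -> 'cV[R]_n) (g : 'cV[R]_n -> R) :
  (forall i, measurable_fun setT (fun w => V w i 0)) -> continuous g ->
  measurable_fun setT (fun w => g (V w)).
Proof.
move=> mV cg; apply: (measurability _ (RGenOInfty.measurableE R)).
move=> _ [_ [a ->] <-]; rewrite setTI.
set U := (fun w => g (V w)) @^-1` _.
pose box (q : 'cV[rat]_n * nat) : set 'cV[R]_n :=
  [set x | forall i, `|x i 0 - ratr (q.1 i 0)| < q.2.+1%:R^-1].
pose sub (q : 'cV[rat]_n * nat) := forall x, box q x -> a < g x.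
have -> : U = \bigcup_q [set w | sub q /\ box q (V w)].
  apply/seteqP; split=> [w|w [q _ [qa qw]]]; last first.
    by rewrite /U /= in_itv /= andbT; exact: qa.
  rewrite /U /= in_itv /= andbT => aw.
  have oU : \forall x \near V w, a < g x by exact: (cvgr_gt _ (cg (V w))).
  have [e /= e0 eU] : nbhs_ball (V w) [set x | a < g x] by rewrite nbhs_ballE.
  have e2 : 0 <= (e / 2)^-1 by rewrite invr_ge0 divr_ge0 // ltW.
  pose k := Num.bound (e / 2)^-1.
  have k2 : k.+1%:R^-1 < e / 2.
    rewrite -[ltRHS]invrK ltf_pV2 ?posrE ?invr_gt0 ?divr_gt0 //.
    by apply: lt_le_trans (archi_boundP e2) _; rewrite ler_nat.
  have k0 : 0 < k.+1%:R^-1 :> R by rewrite invr_gt0.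
  have [r rE] : exists r : R, r = k.+1%:R^-1 by exists k.+1%:R^-1.
  rewrite -rE in k0 k2.
  have ex (i : 'I_n) : exists q : rat, `|V w i 0 - ratr q| < r.
    have [|q] := @rat_in_itvoo R (V w i 0 - r) (V w i 0 + r).
      by lra.
    by rewrite in_itv /= => ?; exists q; rewrite ltr_distl; lra.
  have [q hq] := choice ex.
  exists (\col_i q i, k) => //; split; last by move=> i /=; rewrite mxE -rE.
  move=> x /= bx; apply: eU; rewrite -ball_normE /=.
  apply: le_lt_trans (_ : r + r < e); last by lra.
  apply: mx_norm_le => [|i j]; first by rewrite addr_ge0 // ltW.
  rewrite ord1 !mxE; have := bx i; rewrite mxE -rE => bxi.
  rewrite -(subrK (ratr (q i)) (V w i 0)) -addrA;
    apply: le_trans (ler_normD _ _) _.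
  by rewrite lerD // ltW // distrC.
apply: countable_bigcupT_measurable => [|q]; first exact: countableP.
have [qs|nqs] := pselect (sub q); last first.
  by rewrite (_ : [set w | _] = set0) //; apply/seteqP; split=> // w [].
rewrite (_ : [set w | _] = \bigcap_(i in [set: 'I_n])
  ((fun w => V w i 0) @^-1` (ball (ratr (q.1 i 0) : R) q.2.+1%:R^-1))).
  apply: fin_bigcap_measurable => // i _; rewrite -[X in measurable X]setTI.
  by apply: mV => //; exact: measurable_ball.
apply/seteqP; split=> w /=.
  by move=> [_ bw] i _; rewrite /= -ball_normE /= distrC.
by move=> bw; split=> // i; have := bw i I; rewrite /= -ball_normE /= distrC.
Qed.

End ContinuousMeasurable.

(** * Square-integrable martingales *)

Section L2Martingale.
Context {d : measure_display} {T : measurableType d} {R : realType}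
        (P : probability T R).

Lemma series_shift (u : nat -> R) a j :
  series u (a + j)%N = series u a + \sum_(i < j) u (a + i).
Proof.
elim: j => [|j IH]; first by rewrite addn0 big_ord0 addr0.
by rewrite addnS big_ord_recr /= addrA -IH /series /= big_nat_recr.
Qed.

Lemma adaptedS (F G : set (set T)) (Y : T -> R) :
  F `<=` G -> adapted F Y -> adapted G Y.
Proof.
move=> FG aY _ B mB;
  have : <<s F >> (setT `&` Y @^-1` B) := aY measurableT B mB.
exact: sub_sigma_algebra2.
Qed.

Context (F : nat -> set (set T)) (N : nat -> T -> R) (v : nat -> R).
Hypothesis F_sigma : forall k, sigma_algebra setT (F k).
Hypothesis F_incr : forall k, F k `<=` F k.+1.
Hypothesis F_measurable : forall k, F k `<=` measurable.
Hypothesis N_adapted : forall k, adapted (F k.+1) (N k).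
Hypothesis N_sqr_integrable :
  forall k, P.-integrable setT (EFin \o (fun w => N k w ^+ 2)).
Hypothesis N_variance : forall k, \int[P]_w (N k w ^+ 2) <= v k.
Hypothesis N_orthogonal : forall k (Y : T -> R) (B : R), adapted (F k) Y ->
  (forall w, `|Y w| <= B) -> \int[P]_w (Y w * N k w) = 0.
Hypothesis v_summable : cvgn (series v).

Lemma increment_measurable k : measurable_fun setT (N k).
Proof. exact: (adapted_measurable (F_sigma k.+1)). Qed.

(** [|N| <= 1 + N^2]. *)
Lemma increment_integrable k : P.-integrable setT (EFin \o N k).
Proof.
have i1 : P.-integrable setT (EFin \o (fun w => 1 + N k w ^+ 2)).
  have := integrableD measurableT (finite_measure_integrable_cst P 1 measurableT)
      (N_sqr_integrable k).
  by apply: eq_integrable => // w _ /=; rewrite EFinD.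
apply: le_integrable i1 => //; first by apply/measurable_EFinP;
  exact: increment_measurable.
move=> w _ /=; rewrite lee_fin [leRHS]ger0_norm ?addr_ge0 ?sqr_ge0 //.
rewrite -[N k w ^+ 2]real_normK ?num_real //.
have := sqr_ge0 (`|N k w| - 1); nra.
Qed.

Lemma v_ge0 k : 0 <= v k.
Proof. by apply: le_trans (N_variance k); apply: Rintegral_ge0 => w _;
  rewrite sqr_ge0. Qed.

(** The partial sums from index [a], frozen as soon as they leave
    [(-lam, lam)].  As long as it moves, this process is bounded by [lam], so that
    its increments are orthogonal to it with no integrability to check. *)
Fixpoint stopped (a : nat) (lam : R) (j : nat) (w : T) : R :=
  if j is j'.+1 then
    stopped a lam j' w + (if `|stopped a lam j' w| < lam then N (a + j') w else 0)
  else 0.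

Lemma stopped_adapted a lam j : adapted (F (a + j)) (stopped a lam j).
Proof.
elim: j => [|j IH]; first exact: measurable_cst.
rewrite /adapted /= addnS; have {}IH := adaptedS (@F_incr (a + j)) IH.
apply: measurable_funD; first exact: IH.
apply: measurable_fun_ifT; last exact: measurable_cst.
  apply: measurable_fun_ltr; last exact: measurable_cst.
  by apply: (measurableT_comp (@normr_measurable R setT)); exact: IH.
exact: N_adapted.
Qed.

(** The square of the next value is the square of the present one, plus a bounded
    past factor times an increment, which integrates to zero, plus at most the
    square of the increment. *)
Lemma stopped_variance a lam j :
  P.-integrable setT (EFin \o (fun w => stopped a lam j w ^+ 2)) /\
  \int[P]_w (stopped a lam j w ^+ 2) <= \sum_(i < j) v (a + i).
Proof.
elim: j => [|j [iQ IH]].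
  rewrite big_ord0 /=; split.
    by apply: (finite_measure_integrable_cst P (0 ^+ 2) measurableT).
  by rewrite /Rintegral /= expr0n /= integral_cst // mul0e.
set Q := stopped a lam j in iQ IH *.
have aQ : adapted (F (a + j)) Q := @stopped_adapted a lam j.
pose I w : R := if `|Q w| < lam then 1 else 0.
have aI : adapted (F (a + j)) I.
  apply: measurable_fun_ifT; [|exact: measurable_cst|exact: measurable_cst].
  apply: measurable_fun_ltr; last exact: measurable_cst.
  by apply: (measurableT_comp (@normr_measurable R setT)); exact: aQ.
have mI : measurable_fun setT I := adapted_measurable (F_sigma _) (@F_measurable _) aI.
pose Y w := I w * Q w.
have aY : adapted (F (a + j)) Y by apply: measurable_funM.
have mY : measurable_fun setT Y := adapted_measurable (F_sigma _) (@F_measurable _) aY.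
have YB w : `|Y w| <= `|lam|.
  rewrite /Y /I; case: ifPn => [Ql|]; last by rewrite mul0r normr0.
  by rewrite mul1r (le_trans (ltW Ql)) // ler_norm.
have I1 w : `|I w| <= 1 by rewrite /I; case: ifP; rewrite ?normr1 ?normr0.
have E w : stopped a lam j.+1 w ^+ 2 = Q w ^+ 2 + (2 * (Y w * N (a + j) w) +
    I w * N (a + j) w ^+ 2).
  rewrite /= -/(Q w) /Y /I; case: ifP => _; ring.
have iYN : P.-integrable setT (EFin \o (fun w => Y w * N (a + j) w)).
  exact: (integrable_bounded_mul mY YB (increment_integrable _)).
have i2YN : P.-integrable setT (EFin \o (fun w => 2 * (Y w * N (a + j) w))).
  exact: (integrableZl measurableT 2 iYN).
have iIN : P.-integrable setT (EFin \o (fun w => I w * N (a + j) w ^+ 2)).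
  exact: (integrable_bounded_mul mI I1 (N_sqr_integrable _)).
have iS : P.-integrable setT (EFin \o (fun w => 2 * (Y w * N (a + j) w) +
    I w * N (a + j) w ^+ 2)).
  exact: (integrableD measurableT i2YN iIN).
split.
  rewrite (_ : (fun w => _) = fun w => Q w ^+ 2 + (2 * (Y w * N (a + j) w) +
      I w * N (a + j) w ^+ 2)); last first.
    by apply/funext => w; exact: E.
  exact: (integrableD measurableT iQ iS).
under eq_Rintegral do rewrite E.
rewrite (RintegralD measurableT iQ iS) (RintegralD measurableT i2YN iIN).
rewrite (RintegralZl _ measurableT iYN) (N_orthogonal aY YB) mulr0 add0r.
rewrite big_ord_recr /= lerD //; apply: le_trans (N_variance _).
apply: le_Rintegral => // w _; rewrite ler_piMl ?sqr_ge0 //.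
by rewrite /I; case: ifP.
Qed.

(** If the stopped process is inside at time [j] then it was never frozen, and it
    coincides with the partial sums up to [j]. *)
Lemma stopped_frozen a lam j w :
  `|stopped a lam j w| < lam ->
  forall i, (i <= j)%N ->
    `|stopped a lam i w| < lam /\ stopped a lam i w = \sum_(l < i) N (a + l) w.
Proof.
elim: j => [|j IH] /=.
  by move=> l0 i; rewrite leqn0 => /eqP ->; rewrite big_ord0.
case: ifPn => Qj; last by rewrite addr0 => /(negP Qj).
move=> Qj1 i; rewrite leq_eqVlt => /orP[/eqP ->|]; last by rewrite ltnS;
  exact: IH.
rewrite /= Qj; split=> //.
by rewrite big_ord_recr /=; have [_ ->] := IH Qj j (leqnn j).
Qed.

Lemma stopped_measurable a lam j : measurable_fun setT (stopped a lam j).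
Proof.
exact: (adapted_measurable (F_sigma _) (@F_measurable _) (@stopped_adapted a lam j)).
Qed.

Definition outside (a : nat) (lam : R) (j : nat) : set T :=
  [set w | lam <= `|stopped a lam j w|].

Lemma outside_measurable a lam j : measurable (outside a lam j).
Proof.
rewrite -[X in measurable X]setTI.
have m : measurable_fun setT (fun w => `|stopped a lam j w|).
  exact: (measurableT_comp (@normr_measurable R setT) (stopped_measurable a lam j)).
have := m measurableT `[lam, +oo[%classic (measurable_itv _).
by congr (measurable (_ `&` _)); apply/seteqP; split=> w /=;
  rewrite /outside /= in_itv /= andbT.
Qed.

Definition exits (a : nat) (lam : R) : set T := \bigcup_j outside a lam j.

Lemma exits_measurable a lam : measurable (exits a lam).
Proof.
by apply: bigcup_measurable => j _; exact: outside_measurable.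
Qed.

(** Chebyshev's inequality for the stopped process: once the partial sums
    exceed [lam] the stopped process stays there, so that the event that they
    ever do is an increasing union. *)
Lemma exits_probability (a : nat) (lam : R) : 0 < lam ->
  (P (exits a lam) <= (lam ^- 2 * (limn (series v) - series v a))%:E)%E.
Proof.
move=> lam0; set t := limn (series v) - series v a.
have tail j : \sum_(i < j) v (a + i) <= t.
  rewrite lerBrDl.
  have -> : series v a + \sum_(i < j) v (a + i) = series v (a + j)%N.
    by rewrite series_shift.
  apply: nondecreasing_cvgn_le => //.
  apply/nondecreasing_seqP => k; rewrite /series /= big_nat_recr //=.
  by rewrite lerDl v_ge0.
have bound j : (P (outside a lam j) <= (lam ^- 2 * t)%:E)%E.
  have [iQ vQ] := stopped_variance a lam j.
  have lam2 : 0 < lam ^+ 2 by rewrite exprn_gt0.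
  pose Q2 := EFin \o (fun w => stopped a lam j w ^+ 2).
  have mQ : measurable_fun setT Q2.
    by apply/measurable_EFinP; apply: measurable_funX;
      exact: stopped_measurable.
  have := le_integral_abse P measurableT mQ lam2.
  rewrite setTI.
  have -> : [set x | ((lam ^+ 2)%:E <= `|Q2 x|)%E]
      = outside a lam j.
    apply/funext => w; rewrite /outside; congr is_true.
    rewrite /Q2 /= lee_fin ger0_norm ?sqr_ge0 // -[stopped a lam j w ^+
      2]real_normK ?num_real //.
    by rewrite ler_pXn2r ?nnegrE ?normr_ge0 ?(ltW lam0).
  have -> : (\int[P]_x `|Q2 x|)%E =
      (\int[P]_w (stopped a lam j w ^+ 2))%:E.
    rewrite /Rintegral fineK ?integrable_fin_num //.
    by apply: eq_integral => w _ /=; rewrite ger0_norm ?sqr_ge0.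
  move=> h; rewrite EFinM lee_pdivlMl //; apply: le_trans h _.
  by rewrite lee_fin (le_trans vQ).
have := nondecreasing_cvg_mu (mu :=
    P) (outside_measurable a lam) (exits_measurable a lam).
have nd : {homo outside a lam : n m / (n <= m)%N >-> (n <= m)%O}.
  move=> i j ij; rewrite subsetEset => w /= wi; rewrite /outside /= leNgt;
    apply/negP => wj.
  have [] := stopped_frozen wj ij; move: wi; rewrite /outside /= => wi.
  by rewrite ltNge wi.
move=> /(_ nd) cvP.
rewrite -(cvg_lim _ cvP) //; apply: lime_le; first by apply/cvg_ex; eexists;
  exact: cvP.
by apply: nearW => j; exact: bound.
Qed.

(** The event that the partial sums from index [a] on ever move by [1 / (q + 1)] has
    a probability that tends to zero with the tail of the variances.  Outside a
    null set there is therefore, for each [q], an index [a] from which they do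
    not, which is the Cauchy criterion. *)
Theorem martingale_series_cvg : {ae P, forall w, cvgn (series (N ^~ w))}.
Proof.
pose E q := \bigcap_a exits a (q.+1%:R^-1).
have mE q : measurable (E q) by apply: bigcapT_measurable => a;
  exact: exits_measurable.
have E0 q : P (E q) = 0%E.
  apply/eqP; rewrite eq_le measure_ge0 andbT.
  set lam : R := q.+1%:R^-1; have lam0 : 0 < lam :> R by rewrite invr_gt0.
  have Ea a : (P (E q) <= (lam ^- 2 * (limn (series v) - series v a))%:E)%E.
    apply: le_trans (exits_probability a lam0).
    by apply: le_measure; rewrite ?inE //;
      [exact: exits_measurable|move=> w /(_ a I)].
  have cv : (lam ^- 2 * (limn (series v) - series v a))%:E @[a --> \oo] --> 0%:E.
    apply: cvg_EFin; first exact: nearW.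
    rewrite -[X in _ --> X](mulr0 (lam ^- 2)) -(subrr (limn (series v))).
    by apply: cvgMr; apply: cvgB => //; exact: cvg_cst.
  rewrite -[leRHS]/(0%:E) -(cvg_lim _ cv) //.
  apply: lime_ge; first by apply/cvg_ex; eexists; exact: cv.
  by apply: nearW => a; exact: Ea.
have nE : P.-negligible (\bigcup_q E q).
  by apply: negligible_bigcup => q; apply/negligibleP; [exact: mE|exact: E0].
apply: negligibleS nE => w /= ncv; apply: contrapT => nEw; apply: ncv.
apply/cauchy_cvgP/cauchy_exP => e e0.
pose q := Num.bound e^-1.
have qe : q.+1%:R^-1 < e.
  rewrite -[ltRHS]invrK ltf_pV2 ?posrE ?invr_gt0 //.
  have ei : 0 <= e^-1 by rewrite invr_ge0 ltW.
  by apply: lt_le_trans (archi_boundP ei) _; rewrite ler_nat.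
have [a na] : exists a, ~ exits a (q.+1%:R^-1) w.
  apply/existsNP => h; apply: nEw; exists q => // a _; exact: h.
exists (series (N ^~ w) a); exists a => // k /= ak.
rewrite -ball_normE /=; apply: lt_trans qe.
have Qk : `|stopped a q.+1%:R^-1 (k - a) w| < q.+1%:R^-1.
  by rewrite ltNge; apply/negP => h; apply: na; exists (k - a)%N.
have [Sk SE] := stopped_frozen Qk (leqnn _).
rewrite distrC;
  have -> : series (N ^~ w) k - series (N ^~ w) a = stopped a q.+1%:R^-1 (k - a) w.
  by rewrite SE -[in LHS](subnKC ak) series_shift addrAC subrr add0r.
exact: Sk.
Qed.

End L2Martingale.

(** * Real sequences *)

Section Sequences.
Context {R : realType}.
Implicit Types (u v a b : nat -> R).

Lemma series_ge0 u k : (forall i, 0 <= u i) -> 0 <= series u k.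
Proof. by move=> u0; apply: sumr_ge0 => i _. Qed.

Lemma seriesS u k : series u k.+1 = series u k + u k.
Proof. by rewrite /series /= big_nat_recr. Qed.

Lemma cvg_subsequence (T : topologicalType) (x : nat -> T) (l : T) (s : nat -> nat) :
  (forall j, (j <= s j)%N) -> x @ \oo --> l -> x (s j) @[j --> \oo] --> l.
Proof.
move=> sj xl; apply: (@cvg_comp _ _ _ s x \oo \oo) => // A [K _ KA].
by exists K => // j /= Kj; apply: KA => /=; exact: leq_trans Kj (sj j).
Qed.

(** The pathwise half of the Robbins-Siegmund lemma: both [u - series e] and
    [u + series a - series e] are nonincreasing and bounded below. *)
Lemma perturbed_descent_cvg u a e (lb : R) :
  (forall k, u k.+1 <= u k - a k + e k) -> (forall k, 0 <= a k) ->
  (forall k, lb <= u k) -> cvgn (series e) -> cvgn u /\ cvgn (series a).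
Proof.
move=> desc a0 ulb ce.
have [M [_ Me]] := cvg_seq_bounded ce.
have Me1 k : `|series e k| <= M + 1 by apply: (Me (M + 1)) => //; rewrite ltrDl.
have lower k : lb - (M + 1) <= u k - series e k.
  by rewrite lerB //; apply: le_trans (ler_norm _) (Me1 k).
have cvg1 : cvgn (fun k => u k - series e k).
  apply: nonincreasing_is_cvgn; last by exists (lb - (M + 1)) => _ [k _ <-].
  apply/nonincreasing_seqP => k; rewrite seriesS.
  have := desc k; have := a0 k; lra.
have cvg2 : cvgn (fun k => u k + series a k - series e k).
  apply: nonincreasing_is_cvgn; last first.
    exists (lb - (M + 1)) => _ [k _ <-].
    have := lower k; have := series_ge0 k a0; lra.
  by apply/nonincreasing_seqP => k; rewrite !seriesS; have := desc k; lra.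
split.
  rewrite (_ : u = fun k => (u k - series e k) + series e k); last first.
    by apply/funext => k; rewrite subrK.
  exact: is_cvgD.
rewrite (_ : series a = fun k => (u k +
    series a k - series e k) - (u k - series e k)); last first.
  by apply/funext => k; ring.
exact: is_cvgB.
Qed.

(** If [b >= e] from [K] on, then [e] times the tail of the divergent series of [a]
    is dominated by the bounded tail of the series of [a * b]. *)
Lemma weighted_series_frequently a b e K :
  (forall k, 0 <= a k) -> series a @ \oo --> +oo -> 0 < e ->
  cvgn (series (fun k => a k * b k)) -> exists2 k, (K <= k)%N & b k < e.
Proof.
move=> a0 aoo e0 cab; apply: contrapT => nex.
have be k : (K <= k)%N -> e <= b k.
  by move=> Kk; rewrite leNgt; apply/negP => bk; apply: nex; exists k.
have [M [_ Me]] := cvg_seq_bounded cab.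
have Me1 k : `|series (fun k => a k * b k) k| <= M + 1.
  by apply: (Me (M + 1)) => //; rewrite ltrDl.
set s := series (fun k => a k * b k) in Me1.
have key j : e * (series a (K + j)%N - series a K) <= s (K + j)%N - s K.
  elim: j => [|j IH]; first by rewrite addn0 !subrr mulr0.
  rewrite addnS /s !seriesS -/s.
  have : e * a (K + j)%N <= a (K + j)%N * b (K + j)%N.
    by rewrite mulrC ler_wpM2l // be // leq_addr.
  lra.
move/cvgryPgt: aoo => /(_ (series a K + (2 * (M + 1)) / e)) [J _ Jge].
have := Jge (K + J)%N; rewrite /= leq_addl => /(_ isT).
rewrite -ltrBrDl ltr_pdivrMr // [_ * e]mulrC => /lt_le_trans/(_ (key J)).
have := Me1 (K + J)%N; have := Me1 K;
  rewrite !ler_norml => /andP[? ?] /andP[? ?]; lra.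
Qed.

Lemma limn_esup_le_near u (l : R) :
  (limn_esup (fun k => (u k)%:E) <= l%:E)%E ->
  forall e, 0 < e -> \forall k \near \oo, u k <= l + e.
Proof.
move=> ul e e0.
have : (limn_esup (fun k => (u k)%:E) < (l + e)%:E)%E.
  by apply: le_lt_trans ul _; rewrite lte_fin ltrDl.
rewrite /limn_esup /limf_esup => /ereal_inf_lt[_ [V Voo <-] Vl].
apply: filterS Voo => k Vk; rewrite -lee_fin; apply/ltW; apply: le_lt_trans Vl.
by apply: ereal_sup_ubound; exists k.
Qed.

Lemma frequently_choice (Q : nat -> nat -> Prop) :
  (forall j, exists2 k, (j <= k)%N & Q j k) ->
  exists2 s : nat -> nat, (forall j, (j <= s j)%N) & forall j, Q j (s j).
Proof.
move=> ex; have /choice[s hs] : forall j, exists k, (j <= k)%N /\ Q j k.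
  by move=> j; have [k ? ?] := ex j; exists k.
by exists s => j; have [] := hs j.
Qed.

End Sequences.

(** * Descent of the merit function *)

Section MeritDescent.
Context {R : realType} {n m : nat} (f : 'cV[R]_n -> R)
        (c : 'cV[R]_n -> 'cV[R]_m) (Dom : set 'cV[R]_n) (Lf Lc tau : R).
Hypothesis f_diff : forall z, differentiable (f : 'cV[R]_n -> R^o) z.
Hypothesis c_diff : forall z, differentiable c z.
Hypothesis Dom_convex : convex_set (Dom : set (convex_lmodType 'cV[R]_n)).
Hypothesis Lf_ge0 : 0 <= Lf.
Hypothesis Lc_ge0 : 0 <= Lc.
Hypothesis tau_gt0 : 0 < tau.
Hypothesis f_lip : forall x y, Dom x -> Dom y ->
  norm2 (gradient f x - gradient f y) <= Lf * norm2 (x - y).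
Hypothesis c_lip : forall x y, Dom x -> Dom y ->
  spectral_norm ((nabla c x)^T - (nabla c y)^T) <= Lc * norm2 (x - y).

(** The reduction in the linearised merit function along the direction of the
    deterministic subproblem. *)
Definition predicted_decrease (x d : 'cV[R]_n) : R :=
  norm1 (c x) - tau * dot (gradient f x) d.

(** A step of length [a <= 1] along a direction that solves the linearised
    constraint contracts the linearised constraint by [1 - a];
      the remainders are
    those of the mean value bounds.  The reference direction [d'] is arbitrary. *)
Lemma merit_step x (a : R) d d' :
  0 <= a <= 1 -> Dom x -> Dom (x + a *: d) -> (nabla c x)^T *m d = - c x ->
  merit f c tau (x + a *: d) <=
    merit f c tau x - a * predicted_decrease x d'
    + (a * (tau * dot (gradient f x) (d - d'))
       + (tau * Lf + m%:R * Lc) * a ^+ 2 * norm2 d ^+ 2).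
Proof.
move=> /andP[a0 a1] Dx Dy Jd; rewrite /merit.
have := scalar_taylor Dom_convex Lf_ge0 f_diff f_lip Dx Dy.
have := vector_taylor Dom_convex Lc_ge0 c_diff c_lip Dx Dy.
rewrite addrAC subrr add0r -scalemxAr Jd norm2Z ger0_norm // dotZr exprMn.
rewrite (_ : c x + a *: - c x = (1 - a) *: c x); last first.
  by rewrite scalerN scalerBl scale1r.
rewrite norm1Z ger0_norm ?subr_ge0 // ler_norml => hc /andP[_ hf].
have {}hf := ler_wpM2l (ltW tau_gt0) hf.
rewrite /predicted_decrease dotBr; move: hf hc; lra.
Qed.

(** When the sum [rho] is not positive the hypothesis is void, and [- tau rho >= 0]
    takes its place. *)
Lemma predicted_decrease_ge (nu : R) x d (H : 'M[R]_n) :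
  0 < nu < 1 ->
  (let rho := dot (gradient f x) d + Num.max (dot d (H *m d)) 0 in
   0 < rho -> tau <= (1 - nu) * norm1 (c x) / rho) ->
  nu * norm1 (c x) + tau * Num.max (dot d (H *m d)) 0 <= predicted_decrease x d.
Proof.
move=> /andP[nu0 nu1] /=; rewrite /predicted_decrease.
set g := dot _ d; set M := Num.max _ _; have c0 := norm1_ge0 (c x).
have [rho0|rho0] := ltP 0 (g + M).
  by move=> /(_ isT); rewrite ler_pdivlMr //; lra.
move=> _; have : tau * (g + M) <= 0 by rewrite pmulr_rle0.
have : 0 <= (1 - nu) * norm1 (c x) by rewrite mulr_ge0 // subr_ge0 ltW.
lra.
Qed.

End MeritDescent.

(** * Limit points of a run *)

Section LocalConvergence.
Context {R : realType} {n m : nat} (f : 'cV[R]_n -> R)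
        (c : 'cV[R]_n -> 'cV[R]_m) (Dom : set 'cV[R]_n)
        (tau kappa zeta s0 nu bg bc : R)
        (x d : nat -> 'cV[R]_n) (y : nat -> 'cV[R]_m) (H : nat -> 'M[R]_n)
        (xs : 'cV[R]_n) (eps mu : R) (Z : 'cV[R]_n -> 'M[R]_(n, n - m)).
Hypothesis f_cont : continuous f.
Hypothesis c_cont : continuous c.
Hypothesis grad_cont : continuous (gradient f).
Hypothesis nabla_cont : continuous (nabla c).
Hypothesis tau_gt0 : 0 < tau.
Hypothesis nu_gt0 : 0 < nu.
Hypothesis x_Dom : forall k, Dom (x k).
Hypothesis x_cluster : cluster (x @ \oo) `<=` Dom.
Hypothesis xs_Dom : Dom xs.
Hypothesis grad_bounded : forall z, Dom z -> norm2 (gradient f z) <= bg.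
Hypothesis c_bounded : forall z, Dom z -> norm2 (c z) <= bc.
Hypothesis xs_feasible : c xs = 0.
Hypothesis reg : forall k, regular_newton (H k) (nabla c (x k)) kappa zeta s0.
Hypothesis below : forall z, Dom z ->
  forall y, s0 * norm2 y <= norm2 (nabla c z *m y).
Hypothesis newton : forall k, solves_newton_system (H k) (nabla c (x k))
  (gradient f (x k)) (c (x k)) (d k) (y k).
Hypothesis Z_basis : forall z, Dom z -> norm2 (z - xs) <= eps ->
  orthonormal_null_basis (nabla c z)^T (Z z).
Hypothesis local_growth : forall z, Dom z -> norm2 (z - xs) <= eps -> z <> xs ->
  0 < merit f c tau z - merit f c tau xs
    <= mu * (tau * norm2 ((Z z)^T *m gradient f z) ^+ 2 + norm2 (c z)).
Hypothesis x_limsup : forall e, 0 < e ->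
  \forall k \near \oo, norm2 (x k - xs) <= eps + e.
Hypothesis decrease_ge : forall k,
  nu * norm1 (c (x k)) + tau * Num.max (dot (d k) (H k *m d k)) 0
    <= predicted_decrease f c tau (x k) (d k).
Hypothesis decrease_frequently : forall e K, 0 < e ->
  exists2 k, (K <= k)%N & predicted_decrease f c tau (x k) (d k) < e.
Hypothesis merit_cvg : cvgn (fun k => merit f c tau (x k)).

Local Notation phi := (merit f c tau).

Lemma merit_continuous : continuous phi.
Proof.
suff h (z : 'cV[R]_n) : phi t @[t --> z] --> phi z by exact: h.
have FF : Filter (nbhs z) by exact: nbhs_filter.
have h1 : tau * f t @[t --> z] --> tau * f z by apply: cvgM;
  [apply: cvg_cst|exact: f_cont].
have h2 : norm1 (c t) @[t --> z] --> norm1 (c z) by apply: cvg_norm1;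
  exact: c_cont.
have h3 := cvgD h1 h2.
exact: h3.
Qed.

(** Under a non-strict bound on the limit superior no iterate need lie in the closed
    ball around [xs], but the limit points do. *)
Lemma subsequence_limit (t : nat -> nat) : (forall j, (j <= t j)%N) ->
  exists (s : nat -> nat) (l : 'cV[R]_n),
    [/\ forall j, (j <= s j)%N, x (t (s j)) @[j --> \oo] --> l, Dom l
      & norm2 (l - xs) <= eps].
Proof.
move=> tj.
have [|s [l [sj xl]]] := @bounded_subsequence R n (x \o t) xs (eps + 1).
  have [K _ KP] := x_limsup ltr01.
  by exists K => // j /= Kj; apply: KP => /=; exact: leq_trans Kj (tj j).
exists s, l; split=> //.
  apply: x_cluster => A B [K _ KA] lB.
  have : \forall j \near \oo, B (x (t (s j))) by exact: xl.
  move=> [K' _ K'B]; exists (x (t (s (maxn K K')))); split; last first.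
    by apply: K'B => /=; exact: leq_maxr.
  apply: KA => /=; apply: leq_trans (tj _); apply: leq_trans (sj _).
  exact: leq_maxl.
apply/ler_addgt0Pr => e e0.
have cl : norm2 (x (t (s j)) - xs) @[j --> \oo] --> norm2 (l - xs).
  by apply: cvg_norm2; apply: cvgB xl _; exact: cvg_cst.
rewrite -(cvg_lim _ cl) //; apply: limr_le; first by apply/cvg_ex; eexists;
  exact: cl.
have [K _ KP] := x_limsup e0.
exists K => // j /= Kj; apply: KP => /=.
by apply: leq_trans (tj _); exact: leq_trans Kj (sj j).
Qed.

Lemma direction_sqr_le k : norm2 (d k) ^+ 2 <=
  curvature_constant kappa zeta s0 *
    (Num.max (dot (d k) (H k *m d k)) 0 + bc * norm1 (c (x k))).
Proof.
have /newton_systemE[_ Jd] := newton k.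
apply: le_trans (curvature_bound (reg k) (d k)) _.
rewrite ler_pM2l ?lerD2l; last first.
  by have [_ ? ? ? _ _ _] := reg 0%N; exact: curvature_constant_gt0 (reg k).
rewrite Jd norm2N expr2 ler_pM ?norm2_ge0 ?c_bounded //; exact: norm2_le_norm1.
Qed.

Lemma multiplier_bounded : exists2 B, 0 <= B & forall k, norm2 (y k) <= B.
Proof.
have [_ k0 z0 s00 _ _ _] := reg 0%N.
have bg0 : 0 <= bg := le_trans (norm2_ge0 _) (grad_bounded xs_Dom).
have bc0 : 0 <= bc := le_trans (norm2_ge0 _) (c_bounded xs_Dom).
pose bd := bg / zeta + (kappa / zeta + 1) / s0 * bc.
have bdP k : norm2 (d k) <= bd.
  apply: le_trans (newton_direction_bound (reg k) (newton k)) _.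
  apply: lerD; first by rewrite ler_wpM2r ?invr_ge0 ?(ltW z0) // grad_bounded.
  rewrite ler_wpM2l ?c_bounded //; apply: divr_ge0; last exact: ltW.
  by rewrite addr_ge0 // divr_ge0 // ltW.
exists ((bg + kappa * bd) / s0).
  rewrite divr_ge0 ?(ltW s00) // addr_ge0 // mulr_ge0 ?(ltW k0) //.
  by apply: le_trans (bdP 0%N); exact: norm2_ge0.
move=> k; rewrite ler_pdivlMr // mulrC.
apply: le_trans (newton_multiplier_bound (reg k) (newton k)) _.
by apply: lerD; [exact: grad_bounded|rewrite ler_pM2l].
Qed.

(** The lower bound on the predicted decrease sends [c] and [d] to zero.  For [w]
    in the null space of the limiting Jacobian, [w . grad f = - w . H d - (J^T w) . y]
    tends to zero because the multipliers [y] are bounded. *)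
Lemma stationary_subsequence_limit (u : nat -> nat) l :
  x (u j) @[j --> \oo] --> l ->
  predicted_decrease f c tau (x (u j)) (d (u j)) @[j --> \oo] --> 0 ->
  c l = 0 /\ forall w, (nabla c l)^T *m w = 0 -> dot w (gradient f l) = 0.
Proof.
move=> xl dec0.
have [_ k0 z0 s00 _ _ _] := reg 0%N.
pose M k := Num.max (dot (d k) (H k *m d k)) 0.
have M0 k : 0 <= M k by rewrite /M le_max lexx orbT.
have c1 : norm1 (c (x (u j))) @[j --> \oo] --> 0.
  apply: (@squeeze_cvgr _ _ _ _ (fun=> 0)
    (fun j => nu^-1 * predicted_decrease f c tau (x (u j)) (d (u j)))).
  - apply: nearW => j; rewrite norm1_ge0 /= ler_pdivlMl //.
    apply: le_trans (decrease_ge _); rewrite lerDl mulr_ge0 ?(ltW tau_gt0) //.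
    exact: M0.
  - exact: cvg_cst.
  - by rewrite -(mulr0 nu^-1); exact: cvgMr.
have M1 : M (u j) @[j --> \oo] --> 0.
  apply: (@squeeze_cvgr _ _ _ _ (fun=> 0)
    (fun j => tau^-1 * predicted_decrease f c tau (x (u j)) (d (u j)))).
  - apply: nearW => j; rewrite M0 /= ler_pdivlMl //.
    apply: le_trans (decrease_ge _); rewrite lerDr mulr_ge0 ?(ltW nu_gt0) //.
    exact: norm1_ge0.
  - exact: cvg_cst.
  - by rewrite -(mulr0 tau^-1); exact: cvgMr.
have cl0 : c l = 0.
  have : norm1 (c (x (u j))) @[j --> \oo] --> norm1 (c l).
    by apply: cvg_norm1; apply: (cvg_comp _ c xl); exact: c_cont.
  move/(cvg_unique _ c1) => /(_ (@Rhausdorff R)) n0.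
  by apply/eqP; rewrite -norm2_eq0 eq_le norm2_ge0 n0 norm2_le_norm1.
split=> // w Jw.
have d2 : norm2 (d (u j)) ^+ 2 @[j --> \oo] --> 0.
  apply: (@squeeze_cvgr _ _ _ _ (fun=> 0) (fun j => curvature_constant kappa zeta s0 *
    (M (u j) + bc * norm1 (c (x (u j)))))).
  - by apply: nearW => j; rewrite sqr_ge0; exact: direction_sqr_le.
  - exact: cvg_cst.
  - rewrite -[X in _ --> X](mulr0 (curvature_constant kappa zeta s0));
    apply: cvgMr.
    by rewrite -[X in _ --> X]addr0 -{2}(mulr0 bc); apply: cvgD M1 _;
      exact: cvgMr.
have d0 : norm2 (d (u j)) @[j --> \oo] --> 0.
  have : Num.sqrt (norm2 (d (u j)) ^+ 2) @[j --> \oo] --> Num.sqrt 0.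
    by apply: (cvg_comp _ Num.sqrt d2); exact: sqrt_continuous.
  by rewrite sqrtr0; under eq_fun do rewrite sqrtr_sqr ger0_norm ?norm2_ge0 //.
have [B B0 yB] := multiplier_bounded.
have g1 : dot w (gradient f (x (u j))) @[j --> \oo] --> dot w (gradient f l).
  by apply: cvg_dot; [exact: cvg_cst|apply: (cvg_comp _ (gradient f) xl);
    exact: grad_cont].
apply: (cvg_unique (@Rhausdorff R) g1); apply/norm_cvg0P.
apply: (@squeeze_cvgr _ _ _ _ (fun=> 0) (fun j =>
   kappa * norm2 w * norm2 (d (u j)) + B * norm2 ((nabla c (x (u j)))^T *m w))).
- apply: nearW => j; rewrite normr_ge0 /=.
  have /newton_systemE[hd _] := newton (u j).
  have -> : gradient f (x (u j)) = - (H (u j) *m d (u j) +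
      nabla c (x (u j)) *m y (u j)).
    by rewrite hd opprK.
  rewrite dotNr normrN dotDr; apply: le_trans (ler_normD _ _) _; apply: lerD.
    by rewrite -mulrA; exact: (dot_h_le (reg (u j))).
  rewrite dot_adjoint mulrC; apply: le_trans (cauchy_schwarz _ _) _.
  by rewrite ler_wpM2l ?norm2_ge0.
- exact: cvg_cst.
- rewrite -[X in _ --> X]addr0; apply: cvgD.
    by rewrite -[X in _ --> X](mulr0 (kappa * norm2 w)); exact: cvgMr.
  rewrite -[X in _ --> X](mulr0 B); apply: cvgMr.
  rewrite -[X in _ --> X](@norm20 R m) -Jw; apply: cvg_norm2.
  apply: cvg_mulmx; last exact: cvg_cst.
  by apply: cvg_trmx; apply: (cvg_comp _ (nabla c) xl); exact: nabla_cont.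
Qed.

(** The predicted decrease tends to zero along some subsequence; its limit is
    stationary, so that the upper bound of the growth condition vanishes there
    and forces the limit to be [xs]. *)
Lemma stationary_subsequence : exists2 u : nat -> nat,
  forall j, (j <= u j)%N &
  x (u j) @[j --> \oo] --> xs /\
  forall w, (nabla c xs)^T *m w = 0 -> dot w (gradient f xs) = 0.
Proof.
have [t tj tA] : exists2 t : nat -> nat, (forall j, (j <= t j)%N) &
    forall j, predicted_decrease f c tau (x (t j)) (d (t j)) < j.+1%:R^-1.
  apply: (frequently_choice (Q := fun j k =>
    predicted_decrease f c tau (x k) (d k) < j.+1%:R^-1)) => j.
  by apply: decrease_frequently; rewrite invr_gt0.
have [s [l [sj xl lDom leps]]] := subsequence_limit tj.
have dec_ge0 k : 0 <= predicted_decrease f c tau (x k) (d k).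
  apply: le_trans (decrease_ge k); apply: addr_ge0; apply: mulr_ge0;
    rewrite ?(ltW nu_gt0) ?(ltW tau_gt0) ?norm1_ge0 // le_max lexx orbT //.
have A0 : predicted_decrease f c tau (x (t (s j))) (d (t (s j))) @[j --> \oo] --> 0.
  apply: (@squeeze_cvgr _ _ _ _ (fun=> 0) (@harmonic R)).
  - apply: nearW => j; rewrite dec_ge0 /=; apply: le_trans (ltW (tA (s j))) _.
    by rewrite lef_pV2 ?posrE // ler_nat ltnS.
  - exact: cvg_cst.
  - exact: cvg_harmonic.
have [cl stat] := stationary_subsequence_limit (u := t \o s) xl A0.
have lxs : l = xs.
  apply: contrapT => lxs; have /andP[gt0 le] := local_growth lDom leps lxs.
  have [_ Zl] := Z_basis lDom leps.
  have Z0 : (Z l)^T *m gradient f l = 0.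
    apply/matrixP => i j; rewrite ord1 [RHS]mxE.
    have -> : ((Z l)^T *m gradient f l) i 0 = dot (Z l *m delta_mx i 0) (gradient f l).
      by rewrite -[Z l in RHS]trmxK -dot_adjoint dot_delta.
    by apply: stat; apply/Zl; exists (delta_mx i 0).
  by move: le; rewrite Z0 cl !norm20 expr0n mulr0 addr0 mulr0 leNgt gt0.
exists (t \o s); first by move=> j; apply: leq_trans (sj j) (tj _).
by rewrite -lxs.
Qed.

Lemma merit_limit : phi (x k) @[k --> \oo] --> phi xs.
Proof.
have [u uj [xu _]] := stationary_subsequence.
have p1 : phi (x (u j)) @[j --> \oo] --> phi xs.
  by apply: (cvg_comp _ phi xu); exact: merit_continuous.
have p2 := cvg_subsequence uj merit_cvg.
by rewrite -(cvg_unique (@Rhausdorff R) p2 p1).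
Qed.

(** A subsequence away from [xs] has a limit in the ball, where the merit value
    exceeds that of [xs]; but the merit values converge to the latter. *)
Lemma iterates_limit : x k @[k --> \oo] --> xs.
Proof.
apply/cvg_norm2P/cvgrPdist_lt => e e0; apply: contrapT => nnear.
have [t tj te] : exists2 t : nat -> nat, (forall j, (j <= t j)%N) &
    forall j, e <= norm2 (x (t j) - xs).
  apply: (frequently_choice (Q := fun _ k => e <= norm2 (x k - xs))) => K.
  apply: contrapT => nex; apply: nnear; exists K => // k /= Kk.
  rewrite sub0r normrN ger0_norm ?norm2_ge0 // ltNge; apply/negP => ek.
  by apply: nex; exists k.
have [s [l [sj xl lDom leps]]] := subsequence_limit tj.
have el : e <= norm2 (l - xs).
  have cl : norm2 (x (t (s j)) - xs) @[j --> \oo] --> norm2 (l - xs).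
    by apply: cvg_norm2; apply: cvgB xl _; exact: cvg_cst.
  rewrite -(cvg_lim _ cl) //; apply: limr_ge; first by apply/cvg_ex; eexists;
    exact: cl.
  by apply: nearW => j; exact: te.
have lxs : l <> xs.
  by move=> lxs; move: el; rewrite lxs subrr norm20 leNgt e0.
have /andP[gt0 _] := local_growth lDom leps lxs.
have p1 : phi (x (t (s j))) @[j --> \oo] --> phi l.
  by apply: (cvg_comp _ phi xl); exact: merit_continuous.
have tsj j : (j <= t (s j))%N by apply: leq_trans (sj j) (tj _).
have p2 := cvg_subsequence (s := t \o s) tsj merit_limit.
by move: gt0; rewrite (cvg_unique (@Rhausdorff R) p1 p2) subrr ltxx.
Qed.

(** With a multiplier [ys] of [xs], the pair [(d, y + ys)] solves the Newton
    system for the vanishing right-hand side [grad f - J ys] and [c]. *)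
Lemma direction_limit : norm2 (d k) @[k --> \oo] --> 0.
Proof.
have [_ k0 z0 s00 _ _ _] := reg 0%N.
have [_ _ [_ stat]] := stationary_subsequence.
have [ys gE] := orthogonal_null_range s00 (below xs_Dom) stat.
pose e k := gradient f (x k) - nabla c (x k) *m ys.
have sys k : solves_newton_system (H k) (nabla c (x k)) (e k) (c (x k)) (d k) (y
    k + ys).
  have /newton_systemE[a b] := newton k; apply/newton_systemE; split=> //.
  by rewrite mulmxDr addrA a /e opprB addrC.
have xl := iterates_limit.
have e0 : norm2 (e k) @[k --> \oo] --> 0.
  rewrite -[X in _ --> X](@norm20 R n) -(subrr (gradient f xs)) {2}gE.
  apply: cvg_norm2; apply: cvgB; first by apply: (cvg_comp _ (gradient f) xl);
    exact: grad_cont.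
  by apply: cvg_mulmx; [apply: (cvg_comp _ (nabla c) xl);
    exact: nabla_cont|exact: cvg_cst].
have c0 : norm2 (c (x k)) @[k --> \oo] --> 0.
  rewrite -[X in _ --> X](@norm20 R m) -xs_feasible.
  by apply: cvg_norm2; apply: (cvg_comp _ c xl); exact: c_cont.
apply: (@squeeze_cvgr _ _ _ _ (fun=> 0) (fun k =>
  norm2 (e k) / zeta + (kappa / zeta + 1) / s0 * norm2 (c (x k)))).
- apply: nearW => k; rewrite norm2_ge0 /=.
  exact: (newton_direction_bound (reg k) (sys k)).
- exact: cvg_cst.
- rewrite -[X in _ --> X]addr0; apply: cvgD.
    by rewrite -[X in _ --> X](mul0r zeta^-1); apply: cvgMl.
  by rewrite -[X in _ --> X](mulr0 ((kappa / zeta + 1) / s0)); exact: cvgMr.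
Qed.

Lemma kkt_residual_limit :
  col_mx (gradient f (x k) + nabla c (x k) *m y k) (c (x k)) @[k --> \oo]
    --> (0 : 'cV[R]_(n + m)).
Proof.
have gl : gradient f (x k) + nabla c (x k) *m y k @[k --> \oo] --> (0 : 'cV[R]_n).
  apply/cvg_norm2P;
    apply: (@squeeze_cvgr _ _ _ _ (fun=> 0) (fun k => kappa * norm2 (d k))).
  - apply: nearW => k; rewrite norm2_ge0 /= subr0.
    have /newton_systemE[hd _] := newton k.
    have -> : gradient f (x k) = - (H k *m d k + nabla c (x k) *m y k).
      by rewrite hd opprK.
    rewrite opprD -addrA addNr addr0.
    by rewrite norm2N; exact: (rn_bounded (reg k)).
  - exact: cvg_cst.
  - by rewrite -[X in _ --> X](mulr0 kappa); apply: cvgMr;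
    exact: direction_limit.
have cl : c (x k) @[k --> \oo] --> (0 : 'cV[R]_m).
  by rewrite -xs_feasible; apply: (cvg_comp _ c iterates_limit); exact: c_cont.
move/mx_cvgP: gl => gl; move/mx_cvgP: cl => cl.
apply/mx_cvgP => i j; rewrite mxE -(fintype.splitK i);
  case: (fintype.split i) => i' /=.
  by under eq_fun do rewrite col_mxEu; have := gl i' j; rewrite mxE.
by under eq_fun do rewrite col_mxEd; have := cl i' j; rewrite mxE.
Qed.

End LocalConvergence.

(** * Measurable matrices *)

Section MeasurableMatrices.
Context {d : measure_display} {T : measurableType d} {R : realType}.

Definition measurable_mx p q (A : T -> 'M[R]_(p, q)) : Prop :=
  forall i j, measurable_fun setT (fun w => A w i j).

Lemma measurable_inv (g : T -> R) :
  measurable_fun setT g -> measurable_fun setT (fun w => (g w)^-1).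
Proof.
move=> mg.
(* real powers are measurable, but invert nonnegative numbers only; the factor
   g w restores the sign, and the value 0 at 0 *)
have -> : (fun w => (g w)^-1) = (fun w => g w * powR (g w ^+ 2) (-1)).
  apply/funext => w; have [->|g0] := eqVneq (g w) 0;
    first by rewrite invr0 mul0r.
  by rewrite powR_inv1 ?sqr_ge0 // expr2 invfM mulrA divff // mul1r.
apply: measurable_funM => //.
apply: (measurableT_comp (measurable_powR (-1))).
exact: measurable_funX.
Qed.

Lemma measurable_det p (A : T -> 'M[R]_p) :
  measurable_mx A -> measurable_fun setT (fun w => \det (A w)).
Proof.
move=> mA; apply: measurable_sum => s; apply: measurable_funM;
  first exact: measurable_cst.
by apply: measurable_prod => i _; exact: mA.
Qed.

(** Cramer's rule. *)
Lemma measurable_invmx p (A : T -> 'M[R]_p) :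
  (forall w, A w \in unitmx) -> measurable_mx A -> measurable_mx (fun w => invmx (A w)).
Proof.
move=> uA mA i j.
rewrite (_ : (fun w => _) = (fun w => (\det (A w))^-1 * ((-1) ^+ (j + i) *
    \det (row' j (col' i (A w)))))); last first.
  by apply/funext => w; rewrite /invmx uA !mxE.
apply: measurable_funM; first exact: measurable_inv (measurable_det mA).
apply: measurable_funM; first exact: measurable_cst.
by apply: measurable_det => k l; under eq_fun do rewrite !mxE; exact: mA.
Qed.

Lemma measurable_mulmx p q r (A : T -> 'M[R]_(p, q)) (B : T -> 'M[R]_(q, r)) :
  measurable_mx A -> measurable_mx B -> measurable_mx (fun w => A w *m B w).
Proof.
move=> mA mB i j; under eq_fun do rewrite mxE.
by apply: measurable_sum => k; apply: measurable_funM; [exact: mA|exact: mB].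
Qed.

Lemma measurable_col_mx p1 p2 q (A : T -> 'M[R]_(p1, q)) (B : T -> 'M[R]_(p2, q)) :
  measurable_mx A -> measurable_mx B -> measurable_mx (fun w => col_mx (A w) (B w)).
Proof.
move=> mA mB i j; rewrite -(fintype.splitK i); case: (fintype.split i) => k /=.
  by under eq_fun do rewrite col_mxEu; exact: mA.
by under eq_fun do rewrite col_mxEd; exact: mB.
Qed.

Lemma measurable_tr p q (A : T -> 'M[R]_(p, q)) :
  measurable_mx A -> measurable_mx (fun w => (A w)^T).
Proof. by move=> mA i j; under eq_fun do rewrite mxE; exact: mA. Qed.

Lemma measurable_row_mx p q1 q2 (A : T -> 'M[R]_(p, q1)) (B : T -> 'M[R]_(p, q2)) :
  measurable_mx A -> measurable_mx B -> measurable_mx (fun w => row_mx (A w) (B w)).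
Proof.
move=> mA mB i j; rewrite -(fintype.splitK j); case: (fintype.split j) => k /=.
  by under eq_fun do rewrite row_mxEl; exact: mA.
by under eq_fun do rewrite row_mxEr; exact: mB.
Qed.

Lemma measurable_newton_inverse n m (h : T -> 'M[R]_n) (J : T -> 'M[R]_(n, m)) :
  (forall w, block_mx (h w) (J w) (J w)^T 0 \in unitmx) ->
  measurable_mx h -> measurable_mx J ->
  measurable_mx (fun w => invmx (block_mx (h w) (J w) (J w)^T 0)).
Proof.
move=> uK mh mJ; apply: measurable_invmx => //.
apply: measurable_col_mx; apply: measurable_row_mx => //;
  first exact: measurable_tr.
Qed.

Lemma measurable_continuous_mx n p q (V : T -> 'cV[R]_n)
    (g : 'cV[R]_n -> 'M[R]_(p, q)) :
  measurable_mx V -> continuous g -> measurable_mx (fun w => g (V w)).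
Proof.
move=> mV cg i j;
  apply: (@measurable_continuous_cV _ _ _ n V (fun x => g x i j)).
  by move=> k; exact: mV.
move=> x; apply: (@continuous_comp _ _ _ g (fun A : 'M[R]_(p, q) => A i j)).
  exact: cg.
exact: coord_continuous.
Qed.

End MeasurableMatrices.

(** * Summable expectations *)

Section SummableExpectations.
Context {d : measure_display} {T : measurableType d} {R : realType}
        (P : probability T R).

(** By monotone convergence the sum of the series is integrable, hence finite almost
    everywhere. *)
Lemma nonneg_series_ae_cvg (h : nat -> T -> R) (v : nat -> R) :
  (forall k w, 0 <= h k w) ->
  (forall k, P.-integrable setT (EFin \o h k)) ->
  (forall k, \int[P]_w (h k w) <= v k) -> cvgn (series v) ->
  {ae P, forall w, cvgn (series (h ^~ w))}.
Proof.
move=> h0 ih hv cv.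
have mh k : measurable_fun setT (EFin \o h k) by have /integrableP[] := ih k.
have v0 k : 0 <= v k.
  by apply: le_trans (hv k); apply: Rintegral_ge0 => w _; exact: h0.
pose S w := (\sum_(k <oo) (h k w)%:E)%E.
have S0 w : (0 <= S w)%E by apply: nneseries_ge0 => k _ _; rewrite lee_fin.
have mS : measurable_fun setT S.
  apply: (@ge0_emeasurable_sum _ _ _ setT (fun k w => (h k w)%:E) xpredT) => //.
    by move=> k w _ _; rewrite lee_fin.
  by move=> k _; exact: mh.
have iS : P.-integrable setT S.
  apply/integrableP; split; first exact: mS.
  under eq_integral do rewrite gee0_abs //.
  rewrite integral_nneseries //; last by move=> k w _; rewrite lee_fin.
  apply: le_lt_trans (_ : (limn (series v))%:E < +oo)%E; last exact: ltry.
  apply: lime_le.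
    apply: is_cvg_nneseries => k _ _.
    by apply: integral_ge0 => w _; rewrite lee_fin.
  apply: nearW => j.
  apply: le_trans (_ : ((series v j)%:E <= _)%E).
    rewrite /series /= -sumEFin; apply: lee_sum => k _.
    by rewrite -(fineK (integrable_fin_num measurableT (ih k))) lee_fin;
      exact: hv.
  rewrite lee_fin; apply: nondecreasing_cvgn_le => //.
  by apply/nondecreasing_seqP => k; have := v0 k; rewrite (seriesS v k); lra.
have := integrable_ae measurableT iS; apply: filterS => w /(_ I) Sw.
apply: nondecreasing_is_cvgn.
  by apply/nondecreasing_seqP => k; have := h0 k w;
    rewrite (seriesS (h ^~ w) k); lra.
exists (fine (S w)) => _ [k _ <-]; rewrite -lee_fin fineK //.
rewrite /series /= -sumEFin; apply: nneseries_lim_ge => i _.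
by rewrite lee_fin.
Qed.

Lemma Rintegral_sum0 (I : finType) (h : I -> T -> R) :
  (forall i, P.-integrable setT (EFin \o h i)) ->
  (forall i, \int[P]_w (h i w) = 0) -> \int[P]_w (\sum_i h i w) = 0.
Proof.
move=> ih h0; rewrite /Rintegral; under eq_integral do rewrite -sumEFin.
rewrite integral_sum // big1 // => i _.
by rewrite -(fineK (integrable_fin_num measurableT (ih i))) -[RHS]/(0%:E) -(h0 i).
Qed.

End SummableExpectations.

(** * The history of a run *)

Section History.
Context {d : measure_display} {T : measurableType d} {R : realType} {n : nat}
        (X1 : T -> 'cV[R]_n) (G : nat -> T -> 'cV[R]_n).

Lemma history_sigma k : sigma_algebra setT (history X1 G k).
Proof. exact: smallest_sigma_algebra. Qed.

Lemma history_incr k : history X1 G k `<=` history X1 G k.+1.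
Proof.
apply: sub_sigma_algebra2; apply: setUS => A [j /= jk [i _ Ai]].
by exists j => /=; [exact: ltnW|exists i].
Qed.

Lemma history_measurable k :
  (forall i, measurable_fun setT (fun w => X1 w i 0)) ->
  (forall j i, measurable_fun setT (fun w => G j w i 0)) ->
  history X1 G k `<=` measurable.
Proof.
move=> mX mG; apply: smallest_sub; first exact: sigma_algebra_measurable.
move=> A [[i _ [B mB <-]]|[j _ [i _ [B mB <-]]]].
  exact: mX.
exact: mG.
Qed.

Lemma history_initial k i : adapted (history X1 G k) (fun w => X1 w i 0).
Proof.
move=> _ B mB; apply: sub_sigma_algebra; apply: sub_sigma_algebra; left;
  exists i => //.
by exists B.
Qed.

Lemma history_past k j i : (j < k)%N -> adapted (history X1 G k) (fun w => G j w i 0).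
Proof.
move=> jk _ B mB; apply: sub_sigma_algebra; apply: sub_sigma_algebra; right;
  exists j => //; exists i => //.
by exists B.
Qed.

End History.

(** * Noise of the search directions *)

Lemma is_cvg_series_mull (R : realType) (a : R) (u : nat -> R) :
  cvgn (series u) -> cvgn (series (fun k => a * u k)).
Proof.
move=> cu; rewrite (_ : series _ = fun k => a * series u k); last first.
  by apply/funext => k; rewrite /series /= mulr_sumr.
by apply: is_cvgM => //; exact: is_cvg_cst.
Qed.

Section StochasticNewton.
Context {d : measure_display} {T : measurableType d} {R : realType}
        (P : probability T R) {n m : nat} (f : 'cV[R]_n -> R)
        (c : 'cV[R]_n -> 'cV[R]_m) (tau kappa zeta s0 bg : R)
        (alpha : nat -> R) (X G D Dtrue : nat -> T -> 'cV[R]_n)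
        (Y Ytrue : nat -> T -> 'cV[R]_m) (H : nat -> T -> 'M[R]_n) (x1 : 'cV[R]_n).

Local Notation Fk := (history (X 0%N) G).
Local Notation J k w := (nabla c (X k w)).
Local Notation W k w := (G k w - gradient f (X k w)).

Hypothesis grad_cont : continuous (gradient f).
Hypothesis c_cont : continuous c.
Hypothesis nabla_cont : continuous (nabla c).
Hypothesis X_init : forall w, X 0%N w = x1.
Hypothesis X_step : forall k w, X k.+1 w = X k w + alpha k *: D k w.
Hypothesis grad_bounded : forall k w, norm2 (gradient f (X k w)) <= bg.
Hypothesis reg : forall k w, regular_newton (H k w) (J k w) kappa zeta s0.
Hypothesis newton : forall k w,
  solves_newton_system (H k w) (J k w) (G k w) (c (X k w)) (D k w) (Y k w).
Hypothesis newton_true : forall k w,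
  solves_newton_system (H k w) (J k w) (gradient f (X k w)) (c (X k w))
    (Dtrue k w) (Ytrue k w).
Hypothesis H_adapted : forall k i j, adapted (Fk k) (fun w => H k w i j).
Hypothesis sg : stochastic_gradient_assumption P f X G.
Hypothesis alpha_sqr : cvgn (series (fun k => alpha k ^+ 2)).

Lemma X_initial_measurable i : measurable_fun setT (fun w => X 0%N w i 0).
Proof. by under eq_fun do rewrite X_init; exact: measurable_cst. Qed.

Lemma Fk_measurable k : Fk k `<=` measurable.
Proof.
by apply: history_measurable;
  [exact: X_initial_measurable|exact: (sg_measurable sg)].
Qed.

Lemma direction_formula k w : D k w =
  - usubmx (invmx (block_mx (H k w) (J k w) (J k w)^T 0) *m col_mx (G k w) (c (X k w))).
Proof.
have := newton k w; rewrite /solves_newton_system => K0.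
have uK := newton_matrix_unit (reg k w).
have := congr1 (mulmx (invmx (block_mx (H k w) (J k w) (J k w)^T 0))) K0.
rewrite mulmxA mulVmx // mul1mx mulmxN => /(congr1 usubmx).
by rewrite col_mxKu linearN.
Qed.

Local Notation Tk k := (g_sigma_algebraType (Fk k)).

Lemma G_adapted k i : adapted (Fk k.+1) (fun w => G k w i 0).
Proof. exact: history_past. Qed.

(** The direction is obtained from the data of step [k] by inverting the Newton
    matrix, so that it is determined by the iterate, [H] and the estimate of that
    step. *)
Lemma iterate_adapted k : measurable_mx ((X k) : Tk k -> 'cV[R]_n).
Proof.
elim: k => [|k IH] i j.
  by rewrite ord1; exact: history_initial.
have up p q (A : T -> 'M[R]_(p, q)) : measurable_mx (A : Tk k -> _) ->
    measurable_mx (A : Tk k.+1 -> _).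
  by move=> mA a b; apply: adaptedS (mA a b); exact: history_incr.
have mX := up _ _ _ IH.
have mJ := measurable_continuous_mx mX nabla_cont.
have mc := measurable_continuous_mx mX c_cont.
have mH : measurable_mx (H k : Tk k.+1 -> _) by apply: up => a b;
  exact: H_adapted.
have mG : measurable_mx (G k : Tk k.+1 -> _) by move=> a b; rewrite ord1;
  exact: G_adapted.
have mK := measurable_newton_inverse (T :=
    Tk k.+1) (fun w => newton_matrix_unit (reg k w)) mH mJ.
have mS := measurable_mulmx mK (measurable_col_mx mG mc).
have -> : (fun w : Tk k.+1 => X k.+1 w i j) = (fun w => X k w i j + alpha k *
    - (invmx (block_mx (H k w) (J k w) (J k w)^T 0) *m col_mx (G k w) (c (X k
      w))) (lshift m i) j).
  by apply/funext => w; rewrite X_step direction_formula !mxE;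
    congr (_ + _ * - _); rewrite !mxE.
apply: measurable_funD; first exact: mX.
apply: measurable_funM; first exact: measurable_cst.
by apply: measurable_funN; exact: mS.
Qed.

(** The vector through which the gradient error enters the merit function. *)
Definition noise_coefficient k w : 'cV[R]_n :=
  adjoint_direction (H k w) (J k w) (gradient f (X k w)).

Lemma noise_coefficient_adapted k i :
    adapted (Fk k) (fun w => noise_coefficient k w i 0).
Proof.
have mX := @iterate_adapted k.
have mg := measurable_continuous_mx mX grad_cont.
have mJ := measurable_continuous_mx mX nabla_cont.
have mH : measurable_mx (H k : Tk k -> _) by move=> a b; exact: H_adapted.
have mK := measurable_newton_inverse (T :=
    Tk k) (fun w => newton_matrix_unit (reg k w)) mH mJ.
have m0 : measurable_mx ((fun=> 0) : Tk k -> 'cV[R]_m) by move=> a b;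
  exact: measurable_cst.
have := measurable_mulmx mK (measurable_col_mx mg m0).
move=> /(_ (lshift m i) 0);
  rewrite /adapted /noise_coefficient /adjoint_direction.
by under [X in _ -> measurable_fun _ X]eq_fun do rewrite mxE.
Qed.

Lemma noise_coefficient_bound k w : norm2 (noise_coefficient k w) <= bg / zeta.
Proof.
apply: le_trans (adjoint_direction_bound (reg k w) _) _.
by rewrite ler_wpM2r ?invr_ge0 ?grad_bounded // ltW // (rn_zeta (reg k w)).
Qed.

Definition noise k w : R :=
  alpha k * (tau * dot (gradient f (X k w)) (D k w - Dtrue k w)).

Lemma noiseE k w : noise k w =
  \sum_i - (alpha k * tau) * noise_coefficient k w i 0 * (W k w) i 0.
Proof.
rewrite /noise (adjoint_direction_dot (reg k w) _ (newton k w) (newton_true k w)).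
rewrite dotE mulrA mulrN -mulNr mulr_sumr; apply: eq_bigr => i _.
by rewrite !mulrA.
Qed.

Lemma gradient_adapted k i : adapted (Fk k) (fun w => gradient f (X k w) i 0).
Proof. by case: (sg_unbiased sg k i). Qed.

Lemma gradient_error_integrable k i :
    P.-integrable setT (EFin \o (fun w => (W k w) i 0)).
Proof.
have [iG _ ig _] := sg_unbiased sg k i.
have := integrableB measurableT iG ig; apply: eq_integrable => // w _ /=.
by rewrite !mxE EFinB.
Qed.

Lemma gradient_error_centered k i A : Fk k A -> \int[P]_(w in A) (W k w) i 0 = 0.
Proof.
move=> FA; have [iG _ ig /(_ _ FA) E] := sg_unbiased sg k i.
have mA := Fk_measurable FA.
have iGA := integrableS measurableT mA (@subsetT _ A) iG.
have igA := integrableS measurableT mA (@subsetT _ A) ig.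
have -> : \int[P]_(w in A) (W k w) i 0 =
    \int[P]_(w in A) (G k w i 0 - gradient f (X k w) i 0).
  by apply: eq_Rintegral => w _; rewrite !mxE.
by rewrite (RintegralB mA iGA igA) /Rintegral E subrr.
Qed.

(** The conditional bound is on a version [V] of the conditional expectation and
    holds almost everywhere;
      [V] is replaced by its minimum with [sigma^2], which has
    the same integral. *)
Lemma gradient_error_sqr : exists2 sigma2 : R, 0 <= sigma2 & forall k,
  P.-integrable setT (EFin \o (fun w => norm2 (W k w) ^+ 2)) /\
  \int[P]_w (norm2 (W k w) ^+ 2) <= sigma2.
Proof.
have [sigma s_gt0 sV] := sg_variance sg; exists (sigma ^+ 2);
  first exact: sqr_ge0.
move=> k; have [V [iW mV iV E] Vs] := sV k; split=> //.
have [F0 FC _] := history_sigma (X 0%N) G k.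
have FT : Fk k setT by have := FC _ F0; rewrite setD0.
rewrite /Rintegral -(E _ FT) -/(\int[P]_w V w).
have mV' : measurable_fun setT V.
  by have /integrableP[/measurable_EFinP] := iV.
pose U w := Num.min (V w) (sigma ^+ 2).
have mU : measurable_fun setT U by apply: measurable_minr => //;
  exact: measurable_cst.
have iU : P.-integrable setT (EFin \o U).
  have i1 : P.-integrable setT (EFin \o (fun w => `|V w| + sigma ^+ 2)).
    have := integrableD measurableT (integrable_abse iV)
      (finite_measure_integrable_cst P (sigma ^+ 2) measurableT).
    by apply: eq_integrable => // w _ /=; rewrite EFinD.
  apply: le_integrable i1 => //; first exact/measurable_EFinP.
  move=> w _ /=; rewrite lee_fin [leRHS]ger0_norm ?addr_ge0 ?sqr_ge0 //.
  rewrite /U; case: (leP (V w) (sigma ^+ 2)) => _;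
    first by rewrite lerDl sqr_ge0.
  by rewrite ger0_norm ?sqr_ge0 // lerDr.
have -> : \int[P]_w V w = \int[P]_w U w.
  rewrite /Rintegral; congr fine; apply: ae_eq_integral => //;
    try exact/measurable_EFinP.
  by apply: filterS Vs => w Vw _; rewrite /U /=; congr EFin; rewrite min_l.
have -> : sigma ^+ 2 = \int[P]_w (sigma ^+ 2).
  rewrite /Rintegral integral_cst // -[LHS]/(fine (sigma ^+ 2)%:E) -[in
      LHS](mule1 (sigma ^+ 2)%:E).
  by congr (fine (_ * _))%E; apply/esym; exact: (probability_setT P).
apply: le_Rintegral => //.
  exact: (finite_measure_integrable_cst P (sigma ^+ 2) measurableT).
by move=> w _; rewrite /U ge_min lexx orbT.
Qed.

Lemma noise_adapted k : adapted (Fk k.+1) (noise k).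
Proof.
have -> : noise k = fun w => \sum_i - (alpha k * tau) * noise_coefficient k w i 0
    * (W k w) i 0.
  by apply/funext => w; exact: noiseE.
apply: measurable_sum => i; apply: measurable_funM.
  apply: measurable_funM; first exact: measurable_cst.
  by apply: adaptedS (@noise_coefficient_adapted k i); exact: history_incr.
under eq_fun do rewrite mxE [X in _ + X]mxE.
apply: measurable_funB; first exact: G_adapted.
by apply: adaptedS (@gradient_adapted k i); exact: history_incr.
Qed.

(** The gradient error is centred given the past, and the coefficient is bounded and
    determined by the past. *)
Lemma noise_orthogonal k (Z : T -> R) (B : R) : adapted (Fk k) Z ->
  (forall w, `|Z w| <= B) -> \int[P]_w (Z w * noise k w) = 0.
Proof.
move=> aZ ZB.
have sF := history_sigma (X 0%N) G k.
pose Q i w := Z w * (- (alpha k * tau) * noise_coefficient k w i 0).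
have aQ i : adapted (Fk k) (Q i).
  apply: measurable_funM => //; apply: measurable_funM;
    first exact: measurable_cst.
  exact: noise_coefficient_adapted.
have QB i w : `|Q i w| <= B * (`|- (alpha k * tau)| * (bg / zeta)).
  rewrite /Q !normrM; apply: ler_pM => //.
  rewrite ler_wpM2l //; apply: le_trans (noise_coefficient_bound k w).
  exact: coord_le_norm2.
have mQ i := adapted_measurable sF (@Fk_measurable k) (aQ i).
under eq_Rintegral do rewrite noiseE mulr_sumr.
rewrite (_ : (fun w => _) = fun w => \sum_i (Q i w * (W k w) i 0)); last first.
  by apply/funext => w; apply: eq_bigr => i _; rewrite /Q !mulrA.
apply: Rintegral_sum0 => i.
  exact: integrable_bounded_mul (mQ i) (QB i) (gradient_error_integrable k i).
apply: (bounded_adapted_orthogonal sF (@Fk_measurable k)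
    (gradient_error_integrable k i) _ (aQ i) (QB i)).
by move=> A FA; exact: gradient_error_centered.
Qed.

Lemma noise_sqr_le k w :
  noise k w ^+ 2 <= (tau * (bg / zeta)) ^+ 2 * (alpha k ^+ 2 * norm2 (W k w) ^+ 2).
Proof.
rewrite /noise (adjoint_direction_dot (reg k w) _ (newton k w) (newton_true k w)).
rewrite -/(noise_coefficient k w); set q := dot _ _.
have qB : `|q| <= bg / zeta * norm2 (W k w).
  apply: le_trans (cauchy_schwarz _ _) _.
  by rewrite ler_wpM2r ?norm2_ge0 // noise_coefficient_bound.
have q2 : q ^+ 2 <= (bg / zeta * norm2 (W k w)) ^+ 2.
  rewrite -[leLHS]real_normK ?num_real // ler_pXn2r ?nnegrE //.
  exact: le_trans (normr_ge0 _) qB.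
rewrite (_ : (alpha k * (tau * - q)) ^+ 2 = (tau * alpha k) ^+ 2 * q ^+ 2);
  last by ring.
rewrite (_ : _ * (alpha k ^+ 2 * _) =
    (tau * alpha k) ^+ 2 * (bg / zeta * norm2 (W k w)) ^+ 2).
  by rewrite ler_wpM2l ?sqr_ge0.
rewrite -/(W k w); set t := bg / zeta; ring.
Qed.

Lemma noise_series_cvg : {ae P, forall w, cvgn (series (noise ^~ w))}.
Proof.
have [s2 s20 sW] := gradient_error_sqr.
set C := (tau * (bg / zeta)) ^+ 2.
have iC k : P.-integrable setT (EFin \o (fun w => C * alpha k ^+ 2 * norm2 (W k
    w) ^+ 2)).
  exact: (integrableZl measurableT (C * alpha k ^+ 2) (sW k).1).
have mN k := adapted_measurable (history_sigma (X 0%N) G k.+1) (@Fk_measurable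
    k.+1) (@noise_adapted k).
have iN k : P.-integrable setT (EFin \o (fun w => noise k w ^+ 2)).
  apply: le_integrable (iC k) => //; first by apply/measurable_EFinP;
    exact: measurable_funX.
  move=> w _ /=; rewrite lee_fin ger0_norm ?sqr_ge0 // ger0_norm.
    by rewrite -mulrA; exact: noise_sqr_le.
  by apply: mulr_ge0; rewrite ?sqr_ge0 //; apply: mulr_ge0; rewrite sqr_ge0.
apply: (@martingale_series_cvg _ _ _ P Fk noise (fun k => C * s2 * alpha k ^+ 2)).
- by move=> k; exact: history_sigma.
- by move=> k; exact: history_incr.
- by move=> k; exact: Fk_measurable.
- exact: noise_adapted.
- exact: iN.
- move=> k;
  apply: le_trans (_ : \int[P]_w (C * alpha k ^+ 2 * norm2 (W k w) ^+ 2) <= _).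
    by apply: le_Rintegral => // w _; rewrite -mulrA; exact: noise_sqr_le.
  rewrite (RintegralZl _ measurableT (sW k).1) mulrAC ler_wpM2r ?sqr_ge0 //.
  by rewrite ler_wpM2l ?sqr_ge0 //; exact: (sW k).2.
- by move=> k Z B; exact: noise_orthogonal.
- by apply: is_cvg_series_mull; exact: alpha_sqr.
Qed.

Lemma gradient_error_series_cvg :
  {ae P, forall w, cvgn (series (fun k => alpha k ^+ 2 * norm2 (W k w) ^+ 2))}.
Proof.
have [s2 s20 sW] := gradient_error_sqr.
apply: (@nonneg_series_ae_cvg _ _ _ P (fun k w => alpha k ^+ 2 * norm2 (W k w) ^+ 2)
  (fun k => s2 * alpha k ^+ 2)).
- by move=> k w; rewrite mulr_ge0 ?sqr_ge0.
- by move=> k; exact: (integrableZl measurableT (alpha k ^+ 2) (sW k).1).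
- move=> k;
  rewrite (RintegralZl _ measurableT (sW k).1) mulrC ler_wpM2r ?sqr_ge0 //.
  exact: (sW k).2.
- by apply: is_cvg_series_mull; exact: alpha_sqr.
Qed.

End StochasticNewton.

(** * Almost sure convergence *)

Lemma sqr_le_double (R : realType) (a b r : R) :
  0 <= b -> b <= r + a -> b ^+ 2 <= 2 * r ^+ 2 + 2 * a ^+ 2.
Proof.
move=> b0 bra; have : b ^+ 2 <= (r + a) ^+ 2.
  by rewrite ler_pXn2r ?nnegrE // (le_trans b0).
have := sqr_ge0 (r - a); lra.
Qed.

Theorem theorem3p1 (R : realType) (n m : nat)
  (* objective f = E_iota[F(., iota)] and constraints c *)
  (di dx : measure_display)
  (Omega_iota : measurableType di) (P_iota : probability Omega_iota R)
  (Xi : measurableType dx) (iota : {RV P_iota >-> Xi})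
  (F : 'cV[R]_n -> Xi -> R) (f : 'cV[R]_n -> R) (c : 'cV[R]_n -> 'cV[R]_m)
  (hF : forall x, P_iota.-integrable setT (EFin \o (F x \o iota)))
  (hf : forall x, 'E_P_iota[F x \o iota]%E = (f x)%:E)
  (* a probability measure on the product of countably many copies of
     Omega_iota, for an arbitrary (generated) sigma-algebra *)
  (S : set (set (nat -> Omega_iota)))
  (P : probability (g_sigma_algebraType S) R)
  (* algorithm *)
  (Dom : set 'cV[R]_n) (x1 : 'cV[R]_n) (Lf Gam tau xi : R)
  (beta alpha : nat -> R)
  (X G D Dtrue : nat -> g_sigma_algebraType S -> 'cV[R]_n)
  (Y Ytrue : nat -> g_sigma_algebraType S -> 'cV[R]_m)
  (H : nat -> g_sigma_algebraType S -> 'M[R]_n)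
  (* given the run so far, the k-th component of w determines G k w *)
  (hG : forall k (w w' : nat -> Omega_iota), w k = w' k ->
    (forall j, (j < k)%N -> G j w = G j w') -> G k w = G k w')
  (halg : stochastic_sqp f c Dom x1 Lf Gam tau xi beta alpha
            X G D Dtrue Y Ytrue H)
  (* standing assumptions *)
  (hreg : problem_regularity f c Dom X)
  (hpar : parameter_assumption f c tau xi X G D Dtrue H)
  (hsg : stochastic_gradient_assumption P f X G)
  (hmx : matrix_assumption c X G H)
  (* limit points of the iterates do not leave Dom *)
  (hlim : {ae P, forall w, cluster (X ^~ w @ \oo) `<=` Dom})
  (* local condition at x_star *)
  (xs : 'cV[R]_n) (hxs : Dom xs) (hcxs : c xs = 0)
  (mu eps : R) (hmu : 1 < mu) (heps : 0 < eps)
  (Z : 'cV[R]_n -> 'M[R]_(n, n - m))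
  (hZ : forall x, Dom x -> norm2 (x - xs) <= eps ->
    orthonormal_null_basis (nabla c x)^T (Z x))
  (hloc : forall x, Dom x -> norm2 (x - xs) <= eps ->
    (x = xs -> merit f c tau x - merit f c tau xs = 0) /\
    (x <> xs ->
       0 < merit f c tau x - merit f c tau xs
         <= mu * (tau * norm2 ((Z x)^T *m gradient f x) ^+ 2
                  + norm2 (c x))))
  (hsup : {ae P, forall w,
    (limn_esup (fun k => (norm2 (X k w - xs))%:E) <= eps%:E)%E}) :
  {ae P, forall w,
    [/\ merit f c tau (X k w) @[k --> \oo] --> merit f c tau xs,
        X k w @[k --> \oo] --> xs &
        col_mx (gradient f (X k w) + nabla c (X k w) *m Ytrue k w)
               (c (X k w)) @[k --> \oo] --> (0 : 'cV[R]_(n + m))]}.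
Proof.
case: halg => Lf0 f_lip _ _ tau0 xi0 beta01 beta_oo beta2 alphaE alpha01 X_init
    newton X_step newton_true.
case: hreg => _ [f_diff grad_cont] [c_diff nabla_cont] _ Dom_convex X_Dom
  [fb fbP] [bg bgP] _ _ [bc bcP] [L LP] _ [s0 s00 sing].
case: hpar => nu nu01 par.
case: hmx => H_sym H_adapted [kappa [zeta [kappa0 /andP[zeta0 _] H_bound H_coercive]]].
have f_cont : continuous f by move=> x;
  exact: differentiable_continuous (f_diff x).
have c_cont : continuous c by move=> x; exact: differentiable_continuous.
have below x : Dom x -> forall y, s0 * norm2 y <= norm2 (nabla c x *m y).
  move=> Dx y; rewrite -[nabla c x]trmxK.
  by apply: singular_value_lower_bound => // s; exact: sing.
have reg k w : regular_newton (H k w) (nabla c (X k w)) kappa zeta s0.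
  split=> //; first 1 last.
  - exact: H_coercive.
  - exact: below.
  - move=> u; apply: le_trans (norm2_mulmx _ _) _.
    by rewrite ler_wpM2r ?norm2_ge0.
have c_lip x y : Dom x -> Dom y ->
    spectral_norm ((nabla c x)^T - (nabla c y)^T) <= `|L| * norm2 (x - y).
  move=> Dx Dy; apply: le_trans (LP _ _ Dx Dy) _.
  by rewrite ler_wpM2r ?norm2_ge0 // ler_norm.
pose q := tau * xi / (tau * Lf + Gam).
have alphaq k : alpha k = q * beta k by rewrite alphaE /q; ring.
have q0 : 0 < q.
  have := alpha01 0%N; rewrite alphaq => /andP[+ _].
  by have /andP[b0 _] := beta01 0%N; rewrite pmulr_lgt0.
have alpha_oo : series alpha @ \oo --> +oo.
  rewrite (_ : series alpha = fun k => q * series beta k); last first.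
    apply/funext => k; rewrite /series /= mulr_sumr.
    by apply: eq_bigr => i _; exact: alphaq.
  apply/cvgryPge => A; move/cvgryPge: beta_oo => /(_ (A / q));
    apply: filterS => k.
  by rewrite ler_pdivrMr // mulrC.
have alpha2 : cvgn (series (fun k => alpha k ^+ 2)).
  rewrite (_ : (fun k => alpha k ^+ 2) = fun k => q ^+ 2 * beta k ^+ 2);
    last first.
    by apply/funext => k; rewrite alphaq exprMn.
  exact: is_cvg_series_mull.
have X_step' k w : X k.+1 w = X k w + alpha k *: D k w by exact: X_step.
have H_adapted' k i j : adapted (history (X 0%N) G k) (fun w => H k w i j).
  exact: H_adapted.
have ae1 := noise_series_cvg tau grad_cont c_cont nabla_cont X_init X_step'
  (fun k w => bgP _ (X_Dom k w)) reg newton newton_true H_adapted' hsg alpha2.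
have ae2 := gradient_error_series_cvg hsg alpha2.
apply: filter_app hsup; apply: filter_app hlim; apply: filter_app ae2.
apply: filterS ae1 => w cN cW lim sup.
pose bd := bg / zeta + (kappa / zeta + 1) / s0 * bc.
have bdP k : norm2 (Dtrue k w) <= bd.
  apply: le_trans (newton_direction_bound (reg k w) (newton_true k w)) _.
  apply: lerD; first by rewrite ler_wpM2r ?invr_ge0 ?(ltW zeta0) // bgP.
  rewrite ler_wpM2l ?bcP //; apply: divr_ge0; last exact: ltW.
  by rewrite addr_ge0 // divr_ge0 // ltW.
have DP k : norm2 (D k w) ^+ 2 <=
    2 * bd ^+ 2 + 2 / zeta ^+ 2 * norm2 (G k w - gradient f (X k w)) ^+ 2.
  have := newton_direction_bound (reg k w) (newton_difference (newton k w)
      (newton_true k w)).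
  rewrite norm20 mulr0 addr0; set e := norm2 (G k w - _) => De.
  have : norm2 (D k w) <= bd + e / zeta.
    rewrite -[D k w](subrKC (Dtrue k w)); apply: le_trans (norm2D _ _) _.
    by rewrite lerD.
  have -> : 2 / zeta ^+ 2 * e ^+ 2 = 2 * (e / zeta) ^+ 2.
    by rewrite exprMn exprVn mulrAC -mulrA.
  by apply: sqr_le_double; exact: norm2_ge0.
pose C := tau * Lf + m%:R * `|L|.
have C0 : 0 <= C by rewrite addr_ge0 // mulr_ge0 // ltW.
pose A k := predicted_decrease f c tau (X k w) (Dtrue k w).
pose N k := noise f tau alpha X D Dtrue k w.
(* The perturbation of the descent: the martingale difference, and the second-order
   term with |D k|^2 split into a constant and the squared gradient error. *)
pose e k := N k + (2 * C * bd ^+ 2 * alpha k ^+ 2 + 2 * C / zeta ^+ 2 *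
  (alpha k ^+ 2 * norm2 (G k w - gradient f (X k w)) ^+ 2)).
have ce : cvgn (series e).
  rewrite (_ : e = N + ((fun k => 2 * C * bd ^+ 2 * alpha k ^+ 2) +
      (fun k => 2 * C / zeta ^+ 2 *
    (alpha k ^+ 2 * norm2 (G k w - gradient f (X k w)) ^+ 2)))) //.
  rewrite !seriesD; apply: is_cvgD => //.
  by apply: is_cvgD; apply: is_cvg_series_mull.
have dec_ge k : nu * norm1 (c (X k w)) +
    tau * Num.max (dot (Dtrue k w) (H k w *m Dtrue k w)) 0
    <= predicted_decrease f c tau (X k w) (Dtrue k w).
  by apply: predicted_decrease_ge => //; have [] := par k w.
have A0 k : 0 <= A k.
  apply: le_trans (dec_ge k); have /andP[nu0 _] := nu01.
  by apply: addr_ge0; apply: mulr_ge0;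
    rewrite ?(ltW nu0) ?(ltW tau0) ?norm1_ge0 ?le_max ?lexx ?orbT.
have desc k : merit f c tau (X k.+1 w) <= merit f c tau (X k w) - alpha k * A k + e k.
  have /newton_systemE[_ Jd] := newton k w.
  have /andP[a0 a1] := alpha01 k.
  have Dk1 := X_Dom k.+1 w; rewrite X_step in Dk1 *.
  have a01 : 0 <= alpha k <= 1 by rewrite (ltW a0).
  apply: le_trans (merit_step f_diff c_diff Dom_convex (ltW Lf0) (normr_ge0 L)
    tau0 f_lip c_lip (Dtrue k w) a01 (X_Dom k w) Dk1 Jd) _.
  rewrite -/(A k) lerD2l /e; rewrite -/C lerD2l.
  have := ler_wpM2l (mulr_ge0 C0 (sqr_ge0 (alpha k))) (DP k); lra.
have [merit_cvg Asum] : cvgn (fun k => merit f c tau (X k w)) /\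
    cvgn (series (fun k => alpha k * A k)).
  apply: (perturbed_descent_cvg desc (lb := tau * fb)) => // k.
    by rewrite mulr_ge0 //; have /andP[/ltW] := alpha01 k.
  by rewrite -[leLHS]addr0 lerD ?norm1_ge0 // ler_wpM2l ?(ltW tau0) // fbP.
have A_freq eta K : 0 < eta -> exists2 k, (K <= k)%N & A k < eta.
  move=> eta0; apply: (weighted_series_frequently K _ alpha_oo eta0 Asum) => k.
  by have /andP[/ltW] := alpha01 k.
have growth z : Dom z -> norm2 (z - xs) <= eps -> z <> xs ->
    0 < merit f c tau z - merit f c tau xs
      <= mu * (tau * norm2 ((Z z)^T *m gradient f z) ^+ 2 + norm2 (c z)).
  by move=> Dz ze zxs; have [_] := hloc z Dz ze; apply.
have nu0 : 0 < nu by case/andP: nu01.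
have limsup := limn_esup_le_near sup.
split.
- exact: (merit_limit f_cont c_cont grad_cont nabla_cont tau0 nu0
    (fun k => X_Dom k w) lim hxs bgP bcP (fun k => reg k w)
    (fun k => newton_true k w) hZ growth limsup dec_ge A_freq merit_cvg).
- exact: (iterates_limit f_cont c_cont grad_cont nabla_cont tau0 nu0
    (fun k => X_Dom k w) lim hxs bgP bcP (fun k => reg k w)
    (fun k => newton_true k w) hZ growth limsup dec_ge A_freq merit_cvg).
- exact: (kkt_residual_limit f_cont c_cont grad_cont nabla_cont tau0 nu0
    (fun k => X_Dom k w) lim hxs bgP bcP hcxs (fun k => reg k w) below
    (fun k => newton_true k w) hZ growth limsup dec_ge A_freq merit_cvg).
Qed.
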